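(* Let $L$ be a countable lattice which has a minimum element and which contains no infinite strictly increasing sequence. Then there exists a reflexive Banach space $X_L$ such that $(SP_w(X_L),\le)$ is order-isomorphic to $L$.
   Context: A lattice is a partially ordered set in which any two elements have a least upper bound and a greatest lower bound. A normalized basic sequence $(x_i)$ in a Banach space $X$ generates a spreading model $(\tilde x_i)$ if there exist $\varepsilon_n\downarrow0$ such that for all $n$, $(a_i)_{i=1}^n\subseteq[-1,1]$, $n\le k_1<\cdots<k_n$: $(1+\varepsilon_n)^{-1}\|\sum a_i\tilde x_i\|\le\|\sum a_ix_{k_i}\|\le(1+\varepsilon_n)\|\sum a_i\tilde x_i\|$. $(v_i)$ dominates $(u_i)$ if $\|\sum a_iu_i\|\le C\|\sum a_iv_i\|$ for some $C<\infty$ and all finitely supported $(a_i)$; equivalent means mutual domination. $SP_w(X)$ is the set of equivalence classes of spreading models generated by normalized weakly null sequences in $X$, ordered by $[(\tilde x_i)]\le[(\tilde y_i)]$ iff $(\tilde y_i)$ dominates $(\tilde x_i)$. *)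

(* Defs.v *)
From HB Require Import structures.
From mathcomp Require Import all_boot all_order all_algebra.
From mathcomp Require Import all_classical all_reals all_analysis.
From mathcomp Require Import Rstruct Rstruct_topology.
From Stdlib Require Import Rdefinitions.
Set Implicit Arguments. Unset Strict Implicit. Unset Printing Implicit Defensive.
Import Order.TTheory GRing.Theory Num.Theory.
Import numFieldNormedType.Exports.
Local Open Scope classical_set_scope.
Local Open Scope ring_scope.

Notation RR := Rdefinitions.R.

Definition dual_elt (X : normedModType RR) (f : X -> RR) : Prop :=
  (forall (a : RR) (x y : X), f (a *: x + y) = a * f x + f y) /\ continuous f.

(* M is a bound for f, i.e. |f x| <= M ||x||; the dual norm ||f|| is the least such M *)
Definition fbound (X : normedModType RR) (f : X -> RR) (M : RR) : Prop :=
  forall x : X, `|f x| <= M * `|x|.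

(* Elements of the bidual X^** : linear functionals Phi on X^* with
   |Phi f| <= C ||f|| for all f in X^* (expressed via the bounds M of f). *)
Definition bidual_elt (X : normedModType RR) (Phi : (X -> RR) -> RR) : Prop :=
  (forall (a : RR) (f g : X -> RR), dual_elt f -> dual_elt g ->
      Phi (fun x => a * f x + g x) = a * Phi f + Phi g) /\
  (exists C : RR, forall f : X -> RR, dual_elt f ->
      forall M : RR, fbound f M -> `|Phi f| <= C * M).

Definition reflexive_space (X : normedModType RR) : Prop :=
  forall Phi : (X -> RR) -> RR, bidual_elt Phi ->
    exists x : X, forall f : X -> RR, dual_elt f -> Phi f = f x.

Definition normalized (X : normedModType RR) (x : nat -> X) : Prop :=
  forall n, `|x n| = 1.

Definition weakly_null (X : normedModType RR) (x : nat -> X) : Prop :=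
  forall f : X -> RR, dual_elt f -> (fun n => f (x n)) @ \oo --> (0 : RR).

Definition lspan (X : normedModType RR) (x : nat -> X) : set X :=
  [set y | exists (n : nat) (a : nat -> RR), y = \sum_(i < n) a i *: x i].

Definition basic_seq (X : normedModType RR) (x : nat -> X) : Prop :=
  forall y : X, closure (lspan x) y ->
    exists! a : nat -> RR, (fun n => \sum_(i < n) a i *: x i) @ \oo --> y.

Record seqmodel := SeqModel { sm_space : normedModType RR ; sm_seq : nat -> sm_space }.

(* (x_i) generates the spreading model m = (tilde x_i).
   Indices are 0-based: x i is the paper's x_{i+1}, and k i (0-based index)
   is the paper's k_{i+1}; the paper's condition n <= k_1 reads n <= (k 0).+1. *)
Definition generates_sm (X : normedModType RR) (x : nat -> X) (m : seqmodel) : Prop :=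
  exists eps : nat -> RR,
    (forall p q : nat, leq p q -> eps q <= eps p) /\ eps @ \oo --> (0 : RR) /\
    forall (n : nat) (a : nat -> RR) (k : nat -> nat),
      (forall i, ltn i n -> -1 <= a i <= 1) ->
      (forall i j, ltn i j -> ltn j n -> ltn (k i) (k j)) ->
      leq n (k 0%N).+1 ->
      (1 + eps n)^-1 * `|\sum_(i < n) a i *: sm_seq m i|
        <= `|\sum_(i < n) a i *: x (k i)| /\
      `|\sum_(i < n) a i *: x (k i)|
        <= (1 + eps n) * `|\sum_(i < n) a i *: sm_seq m i|.

Definition dominates (v u : seqmodel) : Prop :=
  exists C : RR, forall (n : nat) (a : nat -> RR),
    `|\sum_(i < n) a i *: sm_seq u i| <= C * `|\sum_(i < n) a i *: sm_seq v i|.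

Definition sm_equiv (u v : seqmodel) : Prop := dominates u v /\ dominates v u.

Definition sm_le (u v : seqmodel) : Prop := dominates v u.

Definition in_SPw (X : normedModType RR) (m : seqmodel) : Prop :=
  exists x : nat -> X, normalized x /\ weakly_null x /\ basic_seq x /\ generates_sm x m.

(* Main.v *)
(** A Musielak-Orlicz sequence space does the job. Every coordinate carries a label
    [l : L], each label occurs infinitely often, and the coordinates labelled [l] use
    the Orlicz function
      [F_l t = t^2 (1 + c_l * sum_(k | ~ l <= p_k) al_k (1 - t ^ ga_k))],  [0 <= t <= 1],
    where [p] enumerates [L] with infinite repetition, [al_k] grows fast, [ga_k] decays
    much faster, and [c_l -> 0] along an enumeration of [L].

    Since [l1 `|` l2 <= p] iff [l1 <= p] and [l2 <= p], joins in [L] correspond to maxima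
    of Orlicz functions up to equivalence; if [l] is not below [l'], then [F_l / F_l'] is
    unbounded, as seen at the scales [k] with [p_k = l'] and [t ^ ga_k = 1/2].

    The factor [h] of [t^2] satisfies [h (s t) <= h s + h t - 1], hence [F_l] is
    submultiplicative. Let [x_n] be normalized, weakly null and generate a spreading
    model, and call [l] big if the coordinates of [x_n] labelled [l] do not tend to [0]
    uniformly. The spreading model dominates [l_2] and the unit vectors of every big
    label, hence those of the joins of big labels; by the chain condition one such join
    [l] lies above all big labels. Conversely, for fixed [t] and [n] large the modular of
    [t x_n] is at most a multiple of [F_l t]: submultiplicativity handles the big labels,
    while for a flat part, or for a label with [c] small, the modular scales like [t^2].
    So the spreading model is equivalent to the unit vectors labelled [l]. *)

Require Import Defs.
From HB Require Import structures.
From mathcomp Require Import all_boot all_order all_algebra.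
From mathcomp Require Import all_classical all_reals all_analysis.
From mathcomp Require Import Rstruct Rstruct_topology.
From mathcomp Require Import ring lra zify.
Import Order.TTheory GRing.Theory Num.Theory.
Import numFieldNormedType.Exports.
Set Implicit Arguments. Unset Strict Implicit. Unset Printing Implicit Defensive.
Local Open Scope classical_set_scope.
Local Open Scope ring_scope.

(** [ofun_quad] is a uniform Delta_2 condition, which lets modular and norm estimates be exchanged.
    [ofun_small] is uniform superlinearity, the source of the shrinking property and hence of
    reflexivity. *)
Record orlicz_family (R : realType) := OrliczFamily {
  ofun :> nat -> R -> R;
  ofun0 : forall j, ofun j 0 = 0;
  ofun1 : forall j, ofun j 1 = 1;
  ofun_norm : forall j t, ofun j `|t| = ofun j t;
  ofun_convex : forall j a s t, 0 <= a <= 1 ->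
    ofun j (a * s + (1 - a) * t) <= a * ofun j s + (1 - a) * ofun j t;
  ofun_quad : forall j c t, 1 <= c -> ofun j (c * t) <= c ^+ 2 * ofun j t;
  ofun_small : forall e, 0 < e -> exists2 N : nat, (0 < N)%N &
    forall j t, `|t| <= 1 -> ofun j (t / N%:R) <= e / N%:R * ofun j t }.

(** * Musielak-Orlicz sequence spaces *)

Section OrliczFunctions.
Variables (R : realType) (F : orlicz_family R).
Implicit Types (j : nat) (s t c : R) (x y : nat -> R).

Lemma ofunN j t : F j (- t) = F j t.
Proof. by rewrite -ofun_norm normrN ofun_norm. Qed.

(** [s] is a convex combination of [t] and [- t], where the function takes equal values. *)
Lemma ofun_le j s t : `|s| <= `|t| -> F j s <= F j t.
Proof.
have [-> |t0] := eqVneq t 0.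
  by rewrite normr0 normr_le0 => /eqP ->.
move=> st; set a := (1 + s / t) / 2.
have r1 : `|s / t| <= 1 by rewrite normf_div ler_pdivrMr ?normr_gt0// mul1r.
have a01 : 0 <= a <= 1 by move: r1; rewrite ler_norml /a => /andP[? ?]; lra.
have -> : s = a * t + (1 - a) * (- t) by rewrite /a; field.
by apply: le_trans (ofun_convex _ _ _ _ a01) _; rewrite ofunN; lra.
Qed.

Lemma ofun_ge0 j t : 0 <= F j t.
Proof. by rewrite -(ofun0 F j); apply: ofun_le; rewrite normr0. Qed.

Lemma ofun_scale j c t : 0 <= c <= 1 -> F j (c * t) <= c * F j t.
Proof.
move=> c01; have := ofun_convex F j t 0 c01.
by rewrite mulr0 addr0 ofun0 mulr0 addr0.
Qed.

Lemma ofun_quad_ge j c t : 0 < c <= 1 -> c ^+ 2 * F j t <= F j (c * t).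
Proof.
move=> /andP[c0 c1].
have c'1 : 1 <= c^-1 by rewrite invf_ge1.
have := ofun_quad F j (c * t) c'1; rewrite mulKf ?gt_eqF// exprVn.
by rewrite -ler_pdivlMl ?invr_gt0 ?exprn_gt0// invrK.
Qed.

Lemma ofun_le1 j t : F j t <= 1 -> `|t| <= 1.
Proof.
move=> Ft; rewrite leNgt; apply/negP => t1.
have t0 : 0 < `|t| by apply: lt_trans t1.
have h : 0 <= `|t|^-1 <= 1 by rewrite invr_ge0 ltW//= invf_le1// ltW.
have := ofun_scale j `|t| h; rewrite mulVf ?gt_eqF// ofun1 ofun_norm.
rewrite mulrC ler_pdivlMr// mul1r => h2.
by have := lt_le_trans t1 (le_trans h2 Ft); rewrite ltxx.
Qed.

Definition orho x n := \sum_(j < n) F j (x j).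

(** Bounding every partial sum of the modular avoids any question of convergence. *)
Definition oball x := forall n, orho x n <= 1.

Lemma orho_ge0 x n : 0 <= orho x n.
Proof. by apply: sumr_ge0 => j _; exact: ofun_ge0. Qed.

Lemma orho_mono x m n : (m <= n)%N -> orho x m <= orho x n.
Proof.
move=> /subnKC <-; rewrite /orho big_split_ord/= lerDl.
by apply: sumr_ge0 => j _; exact: ofun_ge0.
Qed.

Lemma oball_le x y : (forall j, `|x j| <= `|y j|) -> oball y -> oball x.
Proof.
move=> xy By n; apply: le_trans (By n).
by apply: ler_sum => j _; apply: ofun_le.
Qed.

Lemma oball_convex a x y : 0 <= a <= 1 -> oball x -> oball y ->
  oball (fun j => a * x j + (1 - a) * y j).
Proof.
move=> a01 Bx By n.
have : orho (fun j => a * x j + (1 - a) * y j) n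
    <= a * orho x n + (1 - a) * orho y n.
  rewrite /orho !mulr_sumr -big_split/=; apply: ler_sum => j _.
  exact: ofun_convex.
move=> /le_trans; apply; have := Bx n; have := By n.
by move: a01 => /andP[? ?] ? ?; nra.
Qed.

Lemma oball0 : oball (fun=> 0).
Proof. by move=> n; rewrite /orho big1// => j _; rewrite ofun0. Qed.

Lemma oball_coord x j : oball x -> `|x j| <= 1.
Proof.
move=> Bx; apply: (@ofun_le1 j); apply: le_trans (Bx j.+1).
by rewrite /orho big_ord_recr/= lerDr; exact: orho_ge0.
Qed.

Lemma oball_divD x y c d : 0 < c -> 0 < d ->
  oball (fun j => x j / c) -> oball (fun j => y j / d) ->
  oball (fun j => (x j + y j) / (c + d)).
Proof.
move=> c0 d0 Bx By; have cd : 0 < c + d by exact: addr_gt0.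
have a01 : 0 <= c / (c + d) <= 1.
  by rewrite divr_ge0 ?(ltW c0) ?(ltW cd)//= ler_pdivrMr// mul1r lerDl ltW.
have := oball_convex a01 Bx By; congr oball; apply/funext => j.
by field; rewrite !gt_eqF.
Qed.

Lemma oball_div_le x c d : 0 < c -> c <= d ->
  oball (fun j => x j / c) -> oball (fun j => x j / d).
Proof.
move=> c0 cd; apply: oball_le => j; rewrite !normrM ler_wpM2l//.
have d0 := lt_le_trans c0 cd.
by rewrite !gtr0_norm ?invr_gt0// lef_pV2.
Qed.

Lemma oball_divZ x a c : 0 < c ->
  oball (fun j => x j / c) ->
  oball (fun j => a * x j / (`|a| * c)).
Proof.
move=> c0; have [->|a0] := eqVneq a 0.
  by move=> _; under eq_fun do rewrite !mul0r; exact: oball0.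
apply: oball_le => j.
rewrite !(normrM, normfV) normr_id invfM [in leRHS]mulrC.
have h : `|a| != 0 by rewrite normr_eq0.
by rewrite le_eqVlt; apply/orP; left; apply/eqP; field; rewrite h normr_eq0 gt_eqF.
Qed.

Definition orlicz_pred : {pred nat -> R} :=
  [pred x | `[< exists2 c, 0 < c & oball (fun j => x j / c) >]].

Fact orlicz_pred_submod : submod_closed orlicz_pred.
Proof.
split=> [|a x y]; rewrite !inE.
  exists 1 => //; apply: oball_le oball0 => j.
  by rewrite (_ : (0 : nat -> R) j = 0)// mul0r.
move=> [c c0 Bx] [d d0 By].
have [a0|a0] := eqVneq a 0.
  by rewrite a0 scale0r add0r; exists d.
have ac0 : 0 < `|a| * c by rewrite mulr_gt0 ?normr_gt0.
exists (`|a| * c + d); first by rewrite addr_gt0.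
exact: oball_divD (oball_divZ _ c0 Bx) By.
Qed.

HB.instance Definition _ :=
  GRing.isSubmodClosed.Build R (nat -> R) orlicz_pred orlicz_pred_submod.

End OrliczFunctions.

(** * The Luxemburg norm *)

Section OrliczSpace.
Variables (R : realType) (F : orlicz_family R).

Record orlicz := Orlicz { oval :> nat -> R; _ : oval \in orlicz_pred F }.

HB.instance Definition _ := [isSub for oval].
HB.instance Definition _ := [Choice of orlicz by <:].
HB.instance Definition _ := [SubChoice_isSubLmodule of orlicz by <:].

Implicit Types (x y : orlicz) (c : R).

Lemma oP x : exists2 c, 0 < c & oball F (fun j => x j / c).
Proof. by case: x => x /= /[!inE]. Qed.

Lemma ovalD x y j : (x + y) j = x j + y j.
Proof. by rewrite -[oval (x + y)]/(val (x + y)) raddfD. Qed.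

Lemma ovalZ c x j : (c *: x) j = c * x j.
Proof. by rewrite -[oval (c *: x)]/(val (c *: x)) linearZ. Qed.

Lemma oval0 j : (0 : orlicz) j = 0.
Proof. by rewrite -[oval 0]/(val (0 : orlicz)) raddf0. Qed.

Lemma ovalN x j : (- x) j = - x j.
Proof. by rewrite -scaleN1r ovalZ mulN1r. Qed.

Lemma ovalB x y j : (x - y) j = x j - y j.
Proof. by rewrite ovalD ovalN. Qed.

Lemma oval_sum (I : Type) (r : seq I) (P : pred I) (f : I -> orlicz) j :
  (\sum_(i <- r | P i) f i) j = \sum_(i <- r | P i) f i j.
Proof. exact: (big_morph (fun x : orlicz => x j) (fun x y => ovalD x y j) (oval0 j)). Qed.

Lemma orlicz_ext x y : (forall j, x j = y j) -> x = y.
Proof. by move=> xy; apply: val_inj; apply/funext. Qed.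

Definition onorm x : R := inf [set c | 0 < c /\ oball F (fun j => x j / c)].

Lemma onorm_ge0 x : 0 <= onorm x.
Proof.
have [c c0 Bc] := oP x; apply: lb_le_inf; first by exists c.
by move=> d [/ltW].
Qed.

(** [ofun_quad] controls the growth of the modular when the scale shrinks slightly, so the infimum
    defining the norm is attained. *)
Lemma onorm_leP x c : 0 < c -> onorm x <= c <-> oball F (fun j => x j / c).
Proof.
move=> c0; split=> [xc|Bx]; last first.
  by apply: ge_inf; [exists 0 => d [/ltW]|].
move=> n; apply/ler_addgt0Pr => e e0.
(* The factor [q = 1 + e / (3 + e)] satisfies [q ^+ 2 <= 1 + e], which is the loss allowed at the
   end. *)
have [d [d0 Bd] dc] : exists2 d, 0 < d /\ oball F (fun j => x j / d) & d < c * (1 + e / (3 + e)).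
  apply: inf_lt; first by have [d d0 Bd] := oP x; exists d.
  by apply: le_lt_trans xc _; rewrite ltr_pMr// ltrDl divr_gt0//; lra.
set q := 1 + e / (3 + e) in dc.
have q1 : 1 <= q by rewrite lerDl divr_ge0//; lra.
have Bq : oball F (fun j => x j / (c * q)) by apply: oball_div_le Bd => //; exact: ltW.
have : orho F (fun j => x j / c) n <= q ^+ 2 * orho F (fun j => x j / (c * q)) n.
  rewrite /orho mulr_sumr; apply: ler_sum => j _.
  have -> : x j / c = q * (x j / (c * q)).
    by field; rewrite !gt_eqF//; lra.
  exact: ofun_quad.
move=> /le_trans; apply; apply: (@le_trans _ _ (q ^+ 2)).
  by rewrite ler_piMr ?sqr_ge0.
rewrite /q; set r := e / (3 + e).
have r1 : 0 <= r <= 1 by rewrite divr_ge0//= ?ler_pdivrMr//; lra.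
have -> : e = r * (3 + e) by rewrite /r divfK// gt_eqF//; lra.
by move: r1 => /andP[? ?]; nra.
Qed.

Fact ler_onormD x y : onorm (x + y) <= onorm x + onorm y.
Proof.
apply/ler_addgt0Pr => e e0; have e2 : 0 < e / 2 by rewrite divr_gt0.
have nx := onorm_ge0 x; have ny := onorm_ge0 y.
have x0 : 0 < onorm x + e / 2 by lra.
have y0 : 0 < onorm y + e / 2 by lra.
have -> : onorm x + onorm y + e = (onorm x + e / 2) + (onorm y + e / 2) by lra.
apply/onorm_leP; first by lra.
under eq_fun do rewrite ovalD.
apply: oball_divD => //; apply/onorm_leP => //; lra.
Qed.

Let onormZ_le c x : onorm (c *: x) <= `|c| * onorm x.
Proof.
apply/ler_addgt0Pr => e e0.
have nx := onorm_ge0 x; have nc := normr_ge0 c.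
have d0 : 0 < e / (1 + `|c|) by rewrite divr_gt0//; lra.
have [->|c0] := eqVneq c 0.
  rewrite normr0 mul0r add0r; apply/onorm_leP => //.
  apply: oball_le (oball0 F) => j; rewrite ovalZ.
  by rewrite !mul0r.
have c1 : 0 < `|c| by rewrite normr_gt0.
have h : 0 < onorm x + e / `|c| by rewrite ltr_wpDl// divr_gt0.
have -> : `|c| * onorm x + e = `|c| * (onorm x + e / `|c|) by field; rewrite gt_eqF.
apply/onorm_leP; first by rewrite mulr_gt0.
under eq_fun do rewrite ovalZ.
by apply: oball_divZ => //; apply/onorm_leP => //; rewrite lerDl divr_ge0// ltW.
Qed.

Fact onormZ c x : onorm (c *: x) = `|c| * onorm x.
Proof.
apply/eqP; rewrite eq_le onormZ_le/=.
have [->|c0] := eqVneq c 0; first by rewrite normr0 mul0r onorm_ge0.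
rewrite -ler_pdivlMl ?normr_gt0// -normfV.
by rewrite -{1}[x](scalerK c0) onormZ_le.
Qed.

Fact oval_le_onorm x j : `|x j| <= onorm x.
Proof.
apply/ler_addgt0Pr => e e0; have nx := onorm_ge0 x.
have h : 0 < onorm x + e by lra.
have /oball_coord : oball F (fun j => x j / (onorm x + e)).
  by apply/onorm_leP => //; lra.
move=> /(_ j); rewrite normrM normfV (gtr0_norm h).
by rewrite ler_pdivrMr// mul1r.
Qed.

Fact onorm0_eq0 x : onorm x = 0 -> x = 0.
Proof.
move=> x0; apply: orlicz_ext => j; rewrite oval0; apply/eqP.
by rewrite -normr_le0 -x0 oval_le_onorm.
Qed.

HB.instance Definition _ :=
  Lmodule_isNormed.Build R orlicz ler_onormD onormZ onorm0_eq0.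

Lemma orlicz_norm_leP x c : 0 < c ->
  `|x| <= c <-> oball F (fun j => x j / c).
Proof. exact: onorm_leP. Qed.

Lemma orlicz_norm_le1 x : `|x| <= 1 <-> oball F x.
Proof.
rewrite orlicz_norm_leP//; under eq_fun do rewrite divr1.
by [].
Qed.

Lemma oval_le_norm x j : `|x j| <= `|x|.
Proof. exact: oval_le_onorm. Qed.

End OrliczSpace.

(** * Completeness, coordinate projections and unit vectors *)

Section OrliczComplete.
Variables (R : realType) (F : orlicz_family R).
Local Notation X := (orlicz F).
Implicit Types (x y : X) (c : R) (A : pred nat).

(** A Fatou property: finitely many coordinates enter [orho F y n], and on them [u m] eventually
    exceeds [r * y] in absolute value. *)
Lemma oball_lim (T : Type) (G : set_system T) (PG : ProperFilter G)
    (u : T -> nat -> R) (y : nat -> R) :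
  (forall j, u m j @[m --> G] --> y j) ->
  (\forall m \near G, oball F (u m)) -> oball F y.
Proof.
move=> uy Bu n; rewrite leNgt; apply/negP; set S := orho F y n => S1.
have S0 : 0 < S by lra.
(* [r < 1] and yet [r ^+ 2 * S > 1], because [(1 + S) ^+ 2 > 4 * S]. *)
pose r := (1 + S) / (2 * S).
have r01 : 0 < r < 1.
  by rewrite divr_gt0//=; [rewrite ltr_pdivrMr//; lra|lra|lra].
have rS : 1 < r ^+ 2 * S.
  have -> : r ^+ 2 * S = (1 + S) ^+ 2 / (4 * S) by rewrite /r; field; rewrite gt_eqF.
  rewrite ltr_pdivlMr; last by lra.
  have : 0 < (S - 1) ^+ 2 by rewrite exprn_gt0// subr_gt0.
  by rewrite !expr2; nra.
have [r0 r1] := andP r01.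
have near1 : \forall m \near G, forall j : 'I_n, `|r * y j| <= `|u m j|.
  apply: filter_forall => j.
  have [->|yj0] := eqVneq (y j) 0; first by near=> m; rewrite mulr0 normr0.
  have /cvgrPdist_le/(_ ((1 - r) * `|y j|)) := uy j.
  rewrite mulr_gt0 ?normr_gt0 ?subr_gt0// => /(_ isT).
  apply: filterS => m; have := ler_normD (y j - u m j) (u m j).
  by rewrite subrK normrM (gtr0_norm r0); lra.
have [m [Bm um]] := filter_ex (filterI Bu near1).
have : r ^+ 2 * S <= orho F (u m) n.
  rewrite /S /orho mulr_sumr; apply: ler_sum => j _.
  apply: le_trans (ofun_le F j (um j)); apply: ofun_quad_ge.
  by rewrite r0 ltW.
by have := Bm n; lra.
Unshelve. all: by end_near. Qed.

(** The limit is taken coordinatewise, and [oball_lim] transfers norm bounds to it. *)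
Fact orlicz_complete (G : set_system X) :
  ProperFilter G -> cauchy G -> cvg G.
Proof.
move=> PG cG.
have /(cauchyP G) exG := cG.
pose y j : R := lim ((fun x : X => x j) @ G).
have cy j : (fun x : X => x j) @ G --> y j.
  apply: R_complete; apply/cauchyP => e e0.
  have [z Gz] := exG e e0; exists (z j).
  rewrite /= nbhs_simpl; apply: filterS Gz => x /=; rewrite -!ball_normE/=.
  by apply: le_lt_trans; have := oval_le_norm (z - x) j; rewrite ovalB.
have By e z : 0 < e -> G (ball z e) -> oball F (fun j => (z j - y j) / e).
  move=> e0 Gz.
  apply: (@oball_lim _ G PG (fun x j => (z j - oval x j) / e)).
    move=> j; apply: cvgMr_tmp; apply: cvgB; first exact: cvg_cst.
    exact: cy.
  apply: filterS Gz => x; rewrite -ball_normE/= => /ltW.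
  by move/(orlicz_norm_leP _ e0); under eq_fun do rewrite ovalB.
have Xy : y \in orlicz_pred F.
  have [z Gz] := exG 1 ltr01.
  have Xzy : (z : nat -> R) - y \in orlicz_pred F.
    by rewrite inE; exists 1 => //; exact: By.
  have Xz : (z : nat -> R) \in orlicz_pred F by case: (z).
  have -> : y = (z : nat -> R) - ((z : nat -> R) - y) by rewrite opprB subrKC.
  by rewrite rpredB.
apply/cvg_ex; exists (Orlicz Xy); apply/cvgrPdist_le => e e0.
have e2 : 0 < e / 2 by rewrite divr_gt0.
have [z Gz] := exG _ e2.
have zy : `|z - Orlicz Xy| <= e / 2.
  by apply/orlicz_norm_leP => //; under eq_fun do rewrite ovalB; exact: By.
apply: filterS Gz => x; rewrite -ball_normE/= => zx.
apply: le_trans (ler_distD z _ _) _.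
by rewrite (distrC (Orlicz Xy)); lra.
Qed.

HB.instance Definition _ := Uniform_isComplete.Build X orlicz_complete.

Fact orlicz_pred_le (u v : nat -> R) :
  (forall j, `|u j| <= `|v j|) -> v \in orlicz_pred F -> u \in orlicz_pred F.
Proof.
move=> uv; rewrite !inE => -[c c0 Bv]; exists c => //.
by apply: oball_le Bv => j; rewrite !normrM ler_wpM2r.
Qed.

Definition restr A (u : nat -> R) j := if A j then u j else 0.

Fact restr_in A x : restr A x \in orlicz_pred F.
Proof.
case: x => u Xu/=; apply: orlicz_pred_le Xu => j.
by rewrite /restr; case: ifP => // _; rewrite normr0.
Qed.

Definition oproj A x : X := Orlicz (restr_in A x).

Lemma oprojE A x j : oproj A x j = if A j then x j else 0.
Proof. by []. Qed.

Fact ounit_in i : (fun j => (i == j)%:R : R) \in orlicz_pred F.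
Proof.
rewrite inE; exists 1 => // n; rewrite /orho.
case: (ltnP i n) => ni.
  rewrite (bigD1 (Ordinal ni))//= eqxx divr1 ofun1 big1 ?addr0// => j.
  rewrite eq_sym -val_eqE/= => /negPf ->.
  by rewrite mul0r ofun0.
rewrite big1// => j _; rewrite (_ : i == j = false) ?mul0r ?ofun0//.
by apply/negbTE; rewrite neq_ltn (leq_trans (ltn_ord j) ni) orbT.
Qed.

Definition ounit i : X := Orlicz (ounit_in i).

Lemma ounitE i j : ounit i j = (i == j)%:R.
Proof. by []. Qed.

Lemma norm_le_pointwise x y : (forall j, `|x j| <= `|y j|) -> `|x| <= `|y|.
Proof.
move=> xy; apply/ler_addgt0Pr => e e0.
have ye : 0 < `|y| + e by rewrite ltr_wpDl.
apply/orlicz_norm_leP => //.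
apply: (@oball_le _ _ _ (fun j => y j / (`|y| + e))).
  by move=> j; rewrite !normrM ler_wpM2r.
by apply/orlicz_norm_leP => //; rewrite lerDl ltW.
Qed.

Lemma norm_oproj_le A x : `|oproj A x| <= `|x|.
Proof.
by apply: norm_le_pointwise => j; rewrite oprojE; case: ifP; rewrite ?normr0.
Qed.

Lemma norm_ounit i : `|ounit i| = 1.
Proof.
apply/eqP; rewrite eq_le; apply/andP; split; last first.
  by apply: le_trans (oval_le_norm _ i); rewrite ounitE eqxx normr1.
apply/orlicz_norm_le1 => n; rewrite /orho.
case: (ltnP i n) => ni.
  rewrite (bigD1 (Ordinal ni))//= eqxx ofun1 big1 ?addr0// => j.
  rewrite eq_sym -val_eqE/= => /negPf ->.
  by rewrite ofun0.
rewrite big1// => j _; rewrite ounitE (_ : i == j = false) ?ofun0//.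
by apply/negbTE; rewrite neq_ltn (leq_trans (ltn_ord j) ni) orbT.
Qed.

Lemma oproj_ltn n x : oproj (fun j => (j < n)%N) x = \sum_(j < n) x j *: ounit j.
Proof.
apply: orlicz_ext => i; rewrite oprojE oval_sum.
case: (ltnP i n) => ni.
  rewrite (bigD1 (Ordinal ni))// ovalZ ounitE eqxx mulr1 big1 => [|j].
    by rewrite /= addr0.
  by rewrite -val_eqE ovalZ ounitE => /negPf ->; rewrite mulr0.
rewrite big1// => j _; rewrite ovalZ ounitE (_ : (j : nat) == i = false) ?mulr0//.
by apply/negbTE; rewrite neq_ltn (leq_trans (ltn_ord j) ni).
Qed.

Lemma orho_quad (u : nat -> R) c n : 0 < c <= 1 ->
  orho F (fun j => u j / c) n <= c ^- 2 * orho F u n.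
Proof.
move=> /andP[c0 c1]; rewrite /orho mulr_sumr; apply: ler_sum => j _.
by rewrite mulrC -exprVn; apply: ofun_quad; rewrite invf_ge1.
Qed.

Lemma norm_le_orho x c : 0 < c <= 1 ->
  (forall n, orho F x n <= c ^+ 2) -> `|x| <= c.
Proof.
move=> /[dup] c01 /andP[c0 c1] xc; apply/orlicz_norm_leP => // n.
apply: le_trans (orho_quad _ _ c01) _.
by rewrite ler_pdivrMl ?exprn_gt0// mulr1.
Qed.

(** The partial modulars increase to a finite supremum, so the modular of the tails tends to 0;
    [norm_le_orho] turns this into norm smallness. *)
Lemma otail_small x e : 0 < e ->
  exists n, forall m, (n <= m)%N -> `|oproj (fun j => (m <= j)%N) x| <= e.
Proof.
wlog x1 : x e / `|x| <= 1.
  move=> h e0.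
  have nx : 0 < 1 + `|x| by rewrite ltr_pwDl.
  have [||n hn] := h ((1 + `|x|)^-1 *: x) (e / (1 + `|x|)).
  - by rewrite normrZ gtr0_norm ?invr_gt0// ler_pdivrMl// mulr1 lerDr.
  - by rewrite divr_gt0.
  exists n => m /hn.
  have -> : oproj (fun j => (m <= j)%N) ((1 + `|x|)^-1 *: x) =
      (1 + `|x|)^-1 *: oproj (fun j => (m <= j)%N) x.
    apply: orlicz_ext => j; rewrite ovalZ !oprojE ovalZ.
    by case: ifP; rewrite ?mulr0.
  by rewrite normrZ gtr0_norm ?invr_gt0// mulrC ler_pM2r ?invr_gt0.
wlog e1 : e / e <= 1.
  move=> h e0; case: (leP e 1) => e1; first exact: h.
  have [|n hn] := h _ (lexx 1) => //.
  by exists n => m /hn /le_trans; apply; exact: ltW.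
move=> e0; have Bx : oball F x by apply/orlicz_norm_le1.
have sx : has_sup (range (orho F x)).
  by split; [exists (orho F x 0), 0%N|exists 1 => _ [n _ <-]].
have [_ [n _ <-] hn] := sup_adherent (exprn_gt0 2 e0) sx.
exists n => m nm; apply: norm_le_orho; first by rewrite e0 e1.
move=> k.
have hk : orho F x k <= sup (range (orho F x)) by apply: ub_le_sup; [exact: sx.2|exists k].
have hmk : orho F x (maxn n k) <= sup (range (orho F x)) 
  by apply: ub_le_sup; [exact: sx.2|exists (maxn n k)].
have h : orho F (oproj (fun j => (m <= j)%N) x) (maxn n k) <=
    orho F x (maxn n k) - orho F x n.
  rewrite /orho -(subnKC (leq_maxl n k)) !big_split_ord/=.
  rewrite addrAC addrN add0r big1 ?add0r => [|j _]; last first.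
    rewrite /restr leqNgt (leq_trans (ltn_ord j) nm)/=.
    exact: ofun0.
  apply: ler_sum => j _; rewrite /restr; case: ifP => // _.
  by rewrite ofun0; exact: ofun_ge0.
apply: le_trans (orho_mono _ _ (leq_maxr n k)) _.
by apply: le_trans h _; lra.
Qed.

Lemma oproj_compl x n :
  x = oproj (fun j => (j < n)%N) x + oproj (fun j => (n <= j)%N) x.
Proof.
apply: orlicz_ext => j; rewrite ovalD !oprojE (leqNgt n j).
by case: (ltnP j n) => _ /=; rewrite ?addr0 ?add0r.
Qed.

Lemma orhoD_disjoint (u v : nat -> R) n : (forall j, u j = 0 \/ v j = 0) ->
  orho F (fun j => u j + v j) n = orho F u n + orho F v n.
Proof.
move=> uv; rewrite /orho -big_split/=; apply: eq_bigr => j _.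
by case: (uv j) => ->; rewrite ?addr0 ?add0r ofun0 ?addr0 ?add0r.
Qed.

End OrliczComplete.

(** * Reflexivity *)

(* [RR] carries the topology of [RR^o] but no canonical normed module structure. *)
Lemma cvg_RRP (T : Type) (G : set_system T) (FG : Filter G) (f : T -> RR) (l : RR) :
  f @ G --> l <-> forall e : RR, 0 < e -> \forall t \near G, `|l - f t| <= e.
Proof. exact: (@cvgrPdist_le RR RR^o). Qed.

Section DualElements.
Variable X : normedModType RR.
Implicit Types (f g : X -> RR) (x y : X).

Lemma dual_elt0 f : dual_elt f -> f 0 = 0.
Proof.
move=> [lf _]; have := lf (-1) 0 0.
by rewrite scaler0 addr0 mulN1r addNr.
Qed.

Lemma dual_eltZ f a x : dual_elt f -> f (a *: x) = a * f x.
Proof.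
by move=> df; have := df.1 a x 0; rewrite addr0 (dual_elt0 df) addr0.
Qed.

Lemma dual_eltD f x y : dual_elt f -> f (x + y) = f x + f y.
Proof. by move=> df; have := df.1 1 x y; rewrite scale1r mul1r. Qed.

Lemma dual_eltN f x : dual_elt f -> f (- x) = - f x.
Proof. by move=> df; rewrite -scaleN1r dual_eltZ// mulN1r. Qed.

Lemma dual_elt_sum f n (u : nat -> X) : dual_elt f ->
  f (\sum_(i < n) u i) = \sum_(i < n) f (u i).
Proof.
move=> df; elim: n => [|n IH]; first by rewrite !big_ord0 dual_elt0.
by rewrite !big_ord_recr/= dual_eltD// IH.
Qed.

Lemma dual_elt_bounded f : dual_elt f -> exists2 K : RR, 0 < K & fbound f K.
Proof.
move=> df; have /cvg_RRP/(_ 1 ltr01) := df.2 0.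
move=> /nbhs_ballP[d /= d0 hd].
have {}hd x : `|x| < d -> `|f x| <= 1.
  move=> xd; have : ball 0 d x by rewrite -ball_normE/= sub0r normrN.
  by move=> /hd; rewrite dual_elt0// sub0r normrN.
exists (2 / d); first by rewrite divr_gt0.
move=> x; have [->|x0] := eqVneq x 0.
  by rewrite dual_elt0// !normr0 mulr0.
have nx : 0 < `|x| by rewrite normr_gt0.
have c0 : 0 < d / (2 * `|x|) by rewrite divr_gt0// mulr_gt0.
have : `|f ((d / (2 * `|x|)) *: x)| <= 1.
  apply: hd; rewrite normrZ gtr0_norm//.
  have -> : d / (2 * `|x|) * `|x| = d / 2 by field; rewrite normr_eq0.
  by lra.
rewrite dual_eltZ// normrM gtr0_norm//.
rewrite -ler_pdivlMl// mulr1 => /le_trans; apply.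
by rewrite invf_div mulrAC.
Qed.

Lemma fbound_dual_elt f (K : RR) :
  (forall a x y, f (a *: x + y) = a * f x + f y) -> fbound f K -> dual_elt f.
Proof.
move=> lf bf; split => // x; apply/cvg_RRP => e e0.
have K1 : 0 < `|K| + 1 by rewrite ltr_wpDl.
near=> y.
have -> : f x - f y = f (x - y).
  by rewrite -[x - y]addrC -scaleN1r lf mulN1r addrC.
apply: le_trans (bf _) _; apply: (@le_trans _ _ ((`|K| + 1) * `|x - y|)).
  by rewrite ler_wpM2r// (le_trans (ler_norm _))// lerDl.
rewrite -ler_pdivlMl//; near: y.
by apply: cvgr_dist_le; rewrite // mulr_gt0 ?invr_gt0.
Unshelve. all: by end_near. Qed.

End DualElements.

Section Reflexive.
Variable F : orlicz_family RR.
Local Notation X := (orlicz F).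
Implicit Types (f g : X -> RR) (x y : X).

Lemma coord_fbound j : fbound (fun x : X => x j) 1.
Proof. by move=> x; rewrite mul1r oval_le_norm. Qed.

Lemma coord_dual_elt j : dual_elt (fun x : X => x j).
Proof.
apply: fbound_dual_elt (coord_fbound j) => a x y.
by rewrite ovalD ovalZ.
Qed.

Lemma fbound_oball f (M : RR) : 0 <= M -> dual_elt f ->
  (forall x : X, oball F x -> `|f x| <= M) -> fbound f M.
Proof.
move=> M0 df h x; have [->|x0] := eqVneq x 0.
  by rewrite dual_elt0// !normr0 mulr0.
have nx : 0 < `|x| by rewrite normr_gt0.
have : `|f (`|x|^-1 *: x)| <= M.
  apply: h; apply/orlicz_norm_le1.
  by rewrite normrZ gtr0_norm ?invr_gt0// mulVf// gt_eqF.
rewrite dual_eltZ// normrM gtr0_norm ?invr_gt0//.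
by rewrite ler_pdivrMl// mulrC.
Qed.

(* Averages of [N] disjoint vectors of the unit ball tend to [0] by [ofun_small],
   so a functional cannot stay away from [0] on the tails. *)
Lemma dual_elt_shrinking f (e : RR) : dual_elt f -> 0 < e ->
  exists n, forall x, (forall j, (j < n)%N -> x j = 0) -> `|x| <= 1 -> `|f x| <= e.
Proof.
move=> df e0; apply: contrapT => /forallNP hn.
(* Failure yields, beyond every [n], a finitely supported vector where [f] exceeds [e / 2]; the
   other half of [e] pays for cutting off the tail. *)
have {}hn n : exists x : X, exists m, [/\ (forall j, (j < n)%N -> x j = 0),
    (forall j, (m <= j)%N -> x j = 0), `|x| <= 1 & e / 2 < f x].
  have /existsNP[x /not_implyP[x0 /not_implyP[x1 /negP]]] := hn n.
  rewrite -ltNge => fx.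
  wlog fx0 : x x0 x1 fx / 0 <= f x.
    move=> h; case: (leP 0 (f x)) => fx0; first exact: h fx0.
    apply: (h (- x)); rewrite ?normrN// ?dual_eltN// ?normrN//.
      by move=> j /x0; rewrite ovalN => ->; rewrite oppr0.
    by rewrite oppr_ge0 ltW.
  rewrite ger0_norm// in fx.
  have [K K0 bK] := dual_elt_bounded df.
  have [|m hm] := @otail_small _ F x (e / (2 * K)); first by rewrite divr_gt0// mulr_gt0.
  exists (oproj (fun j => (j < m)%N) x), m; split.
  - by move=> j /x0 xj; rewrite oprojE xj; case: ifP.
  - by move=> j mj; rewrite oprojE ltnNge mj.
  - by apply: le_trans (norm_oproj_le _ _) _.
  have : `|f (oproj (fun j => (m <= j)%N) x)| <= e / 2.
    apply: le_trans (bK _) _; apply: (@le_trans _ _ (K * (e / (2 * K)))).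
      by rewrite ler_wpM2l// ?(ltW K0)// hm.
    by rewrite le_eqVlt; apply/orP; left; apply/eqP; field; rewrite gt_eqF.
  have := dual_eltD (oproj (fun j => (j < m)%N) x) (oproj (fun j => (m <= j)%N) x) df.
  rewrite -oproj_compl ler_norml => h /andP[_ h2]; lra.
have [K K0 bK] := dual_elt_bounded df.
(* On vectors of norm at most [d] the functional is at most [e / 4], against the lower bound [e / 2]
   for the average. *)
pose d := Num.min 1 (e / (4 * K)).
have d0 : 0 < d by rewrite lt_min ltr01 divr_gt0// mulr_gt0.
have d1 : d <= 1 by rewrite ge_min lexx.
have [N N0 hN] := ofun_small F (exprn_gt0 2 d0).
have NR : 0 < N%:R :> RR by rewrite ltr0n.
(* [s] is a sum of [k] successive disjoint vectors, so the modulars of its parts add up; for [k = N]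
   the total is [d ^+ 2]. *)
have step k : exists s : X, exists m, [/\ (forall j, (m <= j)%N -> s j = 0),
    e / 2 * k%:R <= f s &
    forall n, orho F (fun j => s j / N%:R) n <= d ^+ 2 * (k%:R / N%:R)].
  elim: k => [|k [s [m [sm fs rs]]]].
    exists 0, 0%N; split.
    - by move=> j _; rewrite oval0.
    - by rewrite dual_elt0// mulr0.
    move=> n; rewrite /orho big1 => [|j _]; last by rewrite oval0 mul0r ofun0.
    by rewrite mul0r mulr0.
  have [x [m' [x0 xm x1 fx]]] := hn m.
  exists (s + x), (maxn m m'); split.
  - move=> j; rewrite geq_max => /andP[mj m'j].
    by rewrite ovalD sm// xm// addr0.
  - by rewrite dual_eltD// -[k.+1%:R]natr1 mulrDr mulr1 lerD// ltW.
  move=> n.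
  have -> : (fun j => (s + x) j / N%:R) = (fun j => s j / N%:R + x j / N%:R).
    by apply/funext => j; rewrite ovalD mulrDl.
  rewrite orhoD_disjoint => [|j]; last first.
    case: (ltnP j m) => jm; [right; rewrite x0|left; rewrite sm]; by rewrite ?mul0r.
  rewrite -[k.+1%:R]natr1 mulrDl mulrDr lerD//.
  have /orlicz_norm_le1 Bx := x1.
  apply: (@le_trans _ _ (d ^+ 2 / N%:R * orho F x n)).
    rewrite /orho mulr_sumr; apply: ler_sum => j _; apply: hN.
    exact: oball_coord.
  by rewrite mul1r ler_piMr// divr_ge0// ?sqr_ge0// ltW.
have [s [m [_ fs rs]]] := step N.
have ns : `|N%:R^-1 *: s| <= d.
  apply: norm_le_orho; first by rewrite d0 d1.
  move=> n; have := rs n; rewrite divff ?gt_eqF// mulr1; apply: le_trans.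
  by apply: ler_sum => j _; rewrite ovalZ mulrC.
have : e / 2 <= f (N%:R^-1 *: s).
  by rewrite dual_eltZ// ler_pdivlMl// mulrC.
have := bK (N%:R^-1 *: s); move: ns.
set z := _ *: s => ns fz.
have : K * `|z| <= e / 4.
  apply: (@le_trans _ _ (K * (e / (4 * K)))).
    by rewrite ler_wpM2l ?(ltW K0)// (le_trans ns)// ge_min lexx orbT.
  by rewrite le_eqVlt; apply/orP; left; apply/eqP; field; rewrite gt_eqF.
have := ler_norm (f z); lra.
Qed.

Lemma orlicz_unit_cvg0 f (j : nat -> nat) : dual_elt f ->
  (forall i, (i <= j i)%N) -> f (ounit F (j i)) @[i --> \oo] --> (0 : RR).
Proof.
move=> df ij; apply/cvg_RRP => e e0.
have [n hn] := dual_elt_shrinking df e0.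
exists n => // i /= ni; rewrite sub0r normrN; apply: hn.
  move=> k kn; rewrite ounitE gtn_eqF//.
  by rewrite (leq_trans kn)// (leq_trans ni).
by rewrite norm_ounit.
Qed.

(** * Representation of bidual elements by their coordinates *)

Section Bidual.
Variables (Phi : (X -> RR) -> RR) (C : RR).
Hypothesis PhiL : forall (a : RR) f g, dual_elt f -> dual_elt g ->
  Phi (fun x => a * f x + g x) = a * Phi f + Phi g.
Hypothesis C0 : 0 < C.
Hypothesis PhiB : forall f, dual_elt f -> forall M, fbound f M -> `|Phi f| <= C * M.

Let dual_fin n (c : nat -> RR) : dual_elt (fun x : X => \sum_(j < n) c j * x j).
Proof.
apply: (@fbound_dual_elt _ _ (\sum_(j < n) `|c j|)) => [a x y|x].
  rewrite mulr_sumr -big_split; apply: eq_bigr => j _.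
  by rewrite ovalD ovalZ /=; ring.
rewrite mulr_suml; apply: le_trans (ler_norm_sum _ _ _) _.
by apply: ler_sum => j _; rewrite normrM ler_wpM2l// oval_le_norm.
Qed.

Let Phi_fin n (c : nat -> RR) :
  Phi (fun x : X => \sum_(j < n) c j * x j) =
  \sum_(j < n) c j * Phi (fun x : X => x j).
Proof.
elim: n => [|n IH].
  rewrite big_ord0; apply/eqP; rewrite -normr_le0.
  rewrite -[leRHS](mulr0 C); apply: PhiB; first exact: dual_fin.
  by move=> x; rewrite big_ord0 normr0 mul0r.
rewrite big_ord_recr/= addrC -IH -PhiL//; last exact: coord_dual_elt.
by congr Phi; apply/funext => x; rewrite big_ord_recr/= addrC.
Qed.

Let xs j := Phi (fun x : X => x j).

(* The functional with coefficients [F j (u j) / u j] norms [u] up to a factor [2]. *)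
Let xs_in : xs \in orlicz_pred F.
Proof.
rewrite inE; exists (2 * C); first by rewrite mulr_gt0.
move=> n; rewrite leNgt; apply/negP.
set u := (fun j => xs j / (2 * C)); set S := orho F u n => S1.
pose c j := F j (u j) / u j.
pose f (x : X) := \sum_(j < n) c j * x j.
have bf : fbound f (S + 1).
  apply: fbound_oball; [lra|exact: dual_fin|].
  (* A Young-type bound: [c j * x j] is at most [F j (u j) + F j (x j)] in absolute value, by one
     summand or the other according to which of [u j] and [x j] is larger. *)
  move=> x Bx; apply: (@le_trans _ _ (S + orho F x n)); last by have := Bx n; lra.
  rewrite /S /orho -big_split/=; apply: le_trans (ler_norm_sum _ _ _) _.
  apply: ler_sum => j _; rewrite /c.
  have Fx := ofun_ge0 F j (x j); have Fu := ofun_ge0 F j (u j).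
  have [u0|u0] := eqVneq (u j) 0.
    by rewrite u0 invr0 mulr0 mul0r normr0 addr_ge0// ofun_ge0.
  have nu : 0 < `|u j| by rewrite normr_gt0.
  rewrite !normrM normfV (ger0_norm Fu) -mulrA.
  case: (leP `|x j| `|u j|) => xu.
    apply: (@le_trans _ _ (F j (u j))); last by rewrite lerDl.
    by rewrite ler_piMr// ler_pdivrMl// mulr1.
  apply: (@le_trans _ _ (F j (x j))); last by rewrite lerDr.
  have nx : 0 < `|x j| by apply: lt_trans xu.
  rewrite mulrA -ler_pdivlMr// ler_pdivrMr// mulrAC.
  have h01 : 0 <= `|u j| / `|x j| <= 1.
    by rewrite divr_ge0//= ler_pdivrMr// mul1r ltW.
  have := ofun_scale F j `|x j| h01; rewrite divfK ?gt_eqF// !ofun_norm.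
  by rewrite mulrC mulrA.
have Pf : Phi f = 2 * C * S.
  rewrite /f Phi_fin /S /orho mulr_sumr; apply: eq_bigr => j _.
  rewrite /c; have [u0|u0] := eqVneq (u j) 0.
    by rewrite u0 invr0 mulr0 mul0r ofun0 mulr0.
  rewrite -[Phi _]/(xs j).
  have -> : xs j = 2 * C * u j by rewrite /u; field; rewrite gt_eqF.
  by field.
(* Since [Phi f = 2 * C * S], the bound [C * (S + 1)] contradicts [S > 1]. *)
have := PhiB (dual_fin n c) bf; rewrite -/f Pf.
move=> /(le_trans (ler_norm _)).
have : 0 < C * (S - 1) by rewrite mulr_gt0// subr_gt0.
by rewrite mulrBr mulrDr !mulr1 -mulrA; lra.
Qed.

(** [Phi] and evaluation at [x] agree on finite combinations of coordinates, and by the shrinking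
    property these approximate [f] in dual norm. *)
Lemma orlicz_bidual : exists x : X, forall f, dual_elt f -> Phi f = f x.
Proof.
exists (Orlicz xs_in) => f df; set x := Orlicz xs_in.
apply/eqP; rewrite -subr_eq0 -normr_le0; apply/ler_addgt0Pr => e e0; rewrite add0r.
have [K K0 bK] := dual_elt_bounded df.
have e1 : 0 < e / (2 * C) by rewrite divr_gt0// mulr_gt0.
have e2 : 0 < e / (2 * K) by rewrite divr_gt0// mulr_gt0.
have [n1 h1] := dual_elt_shrinking df e1.
have [n2 h2] := @otail_small _ F x _ e2.
pose n := maxn n1 n2.
pose fn (y : X) := \sum_(j < n) f (ounit F j) * y j.
have fnE y : fn y = f (oproj (fun j => (j < n)%N) y).
  rewrite oproj_ltn (dual_elt_sum n (fun j => y j *: ounit F j) df).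
  by apply: eq_bigr => j _; rewrite dual_eltZ// mulrC.
have dfn : dual_elt fn by exact: (dual_fin n (fun j => f (ounit F j))).
have PfnE : Phi fn = fn x by exact: (Phi_fin n (fun j => f (ounit F j))).
have Pg : Phi (fun y => (-1) * fn y + f y) = - Phi fn + Phi f.
  by rewrite PhiL// mulN1r.
have gE y : (-1) * fn y + f y = f (oproj (fun j => (n <= j)%N) y).
  by rewrite {2}(oproj_compl y n) dual_eltD// fnE mulN1r addKr.
have dg : dual_elt (fun y : X => (-1) * fn y + f y).
  apply: (@fbound_dual_elt _ _ K) => [a y z|y].
    by rewrite df.1 dfn.1; ring.
  by rewrite gE; apply: le_trans (bK _) _; rewrite ler_wpM2l ?(ltW K0)// norm_oproj_le.
have bg : fbound (fun y : X => (-1) * fn y + f y) (e / (2 * C)).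
  apply: fbound_oball => //; first exact: ltW.
  move=> y /orlicz_norm_le1 By; rewrite gE; apply: h1.
    by move=> j jn; rewrite oprojE leqNgt (leq_trans jn)// leq_maxl.
  by apply: le_trans (norm_oproj_le _ _) _.
have := PhiB dg bg; rewrite Pg PfnE.
have -> : C * (e / (2 * C)) = e / 2 by field; rewrite gt_eqF.
have : `|f x - fn x| <= e / 2.
  have -> : f x - fn x = f (oproj (fun j => (n <= j)%N) x) by rewrite -gE mulN1r addrC.
  apply: le_trans (bK _) _; apply: (@le_trans _ _ (K * (e / (2 * K)))).
    by rewrite ler_wpM2l ?(ltW K0)// h2// leq_maxr.
  by rewrite le_eqVlt; apply/orP; left; apply/eqP; field; rewrite gt_eqF.
rewrite distrC => a b.
have -> : Phi f - f x = (- fn x + Phi f) + (fn x - f x) by ring.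
by apply: le_trans (ler_normD _ _) _; lra.
Qed.

End Bidual.

Theorem orlicz_reflexive : reflexive_space X.
Proof.
move=> Phi [PhiL [C PhiB]].
(* The constant of [bidual_elt] may fail to be positive, hence the enlarged one. *)
apply: (@orlicz_bidual Phi (`|C| + 1) PhiL); first by rewrite ltr_wpDl.
move=> f df M bM; apply: le_trans (PhiB f df M bM) _.
have M0 : 0 <= M.
  have := bM (ounit F 0); rewrite norm_ounit mulr1; exact: le_trans.
by rewrite ler_wpM2r// (le_trans (ler_norm _))// lerDl.
Qed.

End Reflexive.

(** * Orlicz functions with prescribed scales *)

Section ScaleFunctions.
Variable R : realType.
Implicit Types (t s x z g c : R) (S : pred nat) (k n : nat).

(** Weighted AM-GM for [x] and 1 with weights [g] and [1 - g], obtained by using [ln u <= u - 1]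
    twice. *)
Lemma powR_bernoulli x g : 0 <= x -> 0 < g <= 1 -> x `^ g <= 1 + g * (x - 1).
Proof.
move=> x0 /andP[g0 g1].
have [->|xn0] := eqVneq x 0.
  by rewrite powR0 ?gt_eqF//; lra.
have {x0} x0 : 0 < x by rewrite lt_neqAle eq_sym xn0.
set y := 1 + g * (x - 1).
have y0 : 0 < y by rewrite /y; nra.
rewrite /powR (negPf xn0) -[leRHS]lnK ?posrE// ler_expR.
have lnB (a b : R) : 0 < a -> 0 < b -> ln a - ln b <= a / b - 1.
  move=> a0 b0; rewrite -ln_div ?posrE//.
  have := @le_ln1Dx _ (a / b - 1); rewrite subrKC; apply.
  by have := divr_gt0 a0 b0; lra.
have h1 := lnB x y x0 y0; have h2 := lnB 1 y ltr01 y0.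
rewrite ln1 in h2.
have : g * (x / y - 1) + (1 - g) * (1 / y - 1) = 0.
  by rewrite /y; field; rewrite -/y gt_eqF.
have : g * (ln x - ln y) <= g * (x / y - 1) by rewrite ler_wpM2l// ltW.
have : (1 - g) * (0 - ln y) <= (1 - g) * (1 / y - 1) by rewrite ler_wpM2l// subr_ge0.
by nra.
Qed.

(** Truncation at 1 extends the Orlicz functions to the whole line; beyond 1 they equal [t^2]. *)
Definition tau t : R := Num.min 1 `|t|.

Lemma tau_ge0 t : 0 <= tau t. Proof. by rewrite le_min ler01 normr_ge0. Qed.
Lemma tau_le1 t : tau t <= 1. Proof. by rewrite ge_min lexx. Qed.
Lemma tauE t : 0 <= t <= 1 -> tau t = t.
Proof. by move=> /andP[t0 t1]; rewrite /tau ger0_norm// min_r. Qed.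
Lemma tau_ge1 t : 1 <= t -> tau t = 1.
Proof. by move=> t1; rewrite /tau min_l// (le_trans t1)// ler_norm. Qed.
Lemma tau_gt0 t : t != 0 -> 0 < tau t.
Proof. by move=> t0; rewrite lt_min ltr01 normr_gt0. Qed.
Lemma tau_norm t : tau `|t| = tau t. Proof. by rewrite /tau normr_id. Qed.
Lemma tau_le s t : `|s| <= `|t| -> tau s <= tau t.
Proof. by move=> st; rewrite le_min !ge_min lexx st orbT. Qed.

Lemma powR_tau_bounds g t : 0 < g -> 0 <= tau t `^ g <= 1.
Proof.
move=> g0; rewrite powR_ge0/=.
have := @ge0_ler_powR _ g (ltW g0) (tau t) 1; rewrite powR1; apply.
- by rewrite nnegrE tau_ge0.
- by rewrite nnegrE.
exact: tau_le1.
Qed.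

(** The left side is the excess of x^2 (tau x)^g over its tangent at [z]. Homogeneity reduces the
    bound to the ratio [r] of the smaller argument to the larger, where Bernoulli's inequality
    applies. *)
Let bracket_le g x z : 0 < g <= 1 -> 0 <= x -> 0 < z <= 1 ->
  x ^+ 2 * tau x `^ g - z ^+ 2 * z `^ g - (2 + g) * z * z `^ g * (x - z)
  <= (1 + 3 * g) * (x - z) ^+ 2.
Proof.
move=> /[dup] g01 /andP[g0 g1] x0 /andP[z0 z1].
have /andP[P0 P1] := powR_tau_bounds x g0.
have := powR_tau_bounds z g0; rewrite tauE ?(ltW z0)// => /andP[q0 q1].
set P := tau x `^ g in P0 P1 *; set q := z `^ g in q0 q1 *.
case: (leP x z) => xz.
  pose r := x / z.
  have xE : x = r * z by rewrite /r divfK// gt_eqF.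
  have r0 : 0 <= r by rewrite divr_ge0// ltW.
  have r1 : r <= 1 by rewrite ler_pdivrMr// mul1r.
  clearbody r.
  have PE : P = r `^ g * q.
    by rewrite /P tauE ?x0 ?(le_trans xz)// xE powRM// ltW.
  have PB : P <= (1 + g * (r - 1)) * q.
    by rewrite PE ler_wpM2r// powR_bernoulli.
  have r20 : 0 <= r ^+ 2 by rewrite sqr_ge0.
  rewrite xE; apply: (@le_trans _ _ (z ^+ 2 * (q * ((r - 1) ^+ 2 * (1 + g * (r + 1)))))).
    have : r ^+ 2 * P <= r ^+ 2 * ((1 + g * (r - 1)) * q) by rewrite ler_wpM2l.
    move=> h; have := ler_wpM2l (sqr_ge0 z) h; lra.
  have -> : (1 + 3 * g) * (r * z - z) ^+ 2 = z ^+ 2 * ((r - 1) ^+ 2 * (1 + 3 * g)) by ring.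
  rewrite ler_wpM2l ?sqr_ge0//.
  apply: (@le_trans _ _ ((r - 1) ^+ 2 * (1 + g * (r + 1)))).
    by rewrite ler_piMl// mulr_ge0 ?sqr_ge0//; nra.
  by rewrite ler_wpM2l ?sqr_ge0//; nra.
have x1 : 0 < x by lra.
pose r := z / x.
have zE : z = r * x by rewrite /r divfK// gt_eqF.
have r0 : 0 < r by rewrite divr_gt0.
have r1 : r <= 1 by rewrite ler_pdivrMr// mul1r ltW.
clearbody r.
pose v := g * (1 - r) / r.
have v0 : 0 <= v by rewrite divr_ge0 ?(ltW r0)// mulr_ge0 ?(ltW g0)// subr_ge0.
have rv : 1 - v <= r `^ g.
  have h := @powR_bernoulli r^-1 g _ g01.
  have {}h : (r `^ g)^-1 <= 1 + v.
    have -> : (r `^ g)^-1 = (r^-1) `^ g.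
      have rg : 0 < r `^ g by rewrite powR_gt0.
      apply: (mulfI (lt0r_neq0 rg)); rewrite divff ?gt_eqF//.
      by rewrite -powRM ?invr_ge0 ?(ltW r0)// divff ?gt_eqF// powR1.
    apply: le_trans (h _) _; first by rewrite invr_ge0 ltW.
    by rewrite /v le_eqVlt; apply/orP; left; apply/eqP; field; rewrite gt_eqF.
  have rg : 0 < r `^ g by rewrite powR_gt0.
  have {h} : 1 <= (1 + v) * r `^ g by rewrite -ler_pdivrMr// mul1r.
  by nra.
have qP : P * (1 - v) <= q.
  apply: (@le_trans _ _ (P * r `^ g)); first by rewrite ler_wpM2l.
  have -> : q = x `^ g * r `^ g.
    by rewrite mulrC -(powRM _ (ltW r0) x0) -zE.
  rewrite ler_wpM2r ?powR_ge0//.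
  apply: ge0_ler_powR; rewrite ?nnegrE ?tau_ge0 ?(ltW g0)//.
  by rewrite /tau ge_min (ger0_norm x0) lexx orbT.
pose B := r ^+ 2 + (2 + g) * r * (1 - r).
have B0 : 0 <= B.
  by rewrite addr_ge0 ?sqr_ge0// !mulr_ge0 ?(ltW r0)//; lra.
have vB : v * B = g * (1 - r) * (r + (2 + g) * (1 - r)).
  by rewrite /v /B; field; rewrite gt_eqF.
rewrite zE.
apply: (@le_trans _ _ (x ^+ 2 * (P * (1 - (1 - v) * B)))).
  have -> : x ^+ 2 * P - (r * x) ^+ 2 * q - (2 + g) * (r * x) * q * (x - r * x)
      = x ^+ 2 * (P - q * B) by rewrite /B; ring.
  rewrite ler_wpM2l ?sqr_ge0// mulrBr mulr1 lerB// mulrA.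
  by rewrite ler_wpM2r.
have -> : 1 - (1 - v) * B = (1 - r) ^+ 2 * (1 + 2 * g + g ^+ 2).
  have -> : 1 - (1 - v) * B = 1 - B + v * B by ring.
  by rewrite vB /B; ring.
have -> : (1 + 3 * g) * (x - r * x) ^+ 2 = x ^+ 2 * ((1 - r) ^+ 2 * (1 + 3 * g)) by ring.
rewrite ler_wpM2l ?sqr_ge0//.
have g2 : 0 <= 1 + 2 * g + g ^+ 2 by rewrite addr_ge0 ?sqr_ge0//; lra.
apply: (@le_trans _ _ ((1 - r) ^+ 2 * (1 + 2 * g + g ^+ 2))).
  by rewrite ler_piMl// mulr_ge0 ?sqr_ge0.
by rewrite ler_wpM2l ?sqr_ge0// expr2; nra.
Qed.

(* Convexity of [t |-> t^2 (1 - tau t ^ g) + 3 g t^2] on the half-line, in the form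
   of tangent lines. *)
Lemma sqr_powR_tangent g z : 0 < g <= 1 -> 0 < z ->
  exists m, forall x, 0 <= x ->
    z ^+ 2 * (1 - tau z `^ g) + 3 * g * z ^+ 2 + m * (x - z) <=
    x ^+ 2 * (1 - tau x `^ g) + 3 * g * x ^+ 2.
Proof.
move=> /[dup] g01 /andP[g0 g1] z0; case: (leP z 1) => z1.
  (* The slope is the derivative at [z]. *)
  exists (2 * z - (2 + g) * z * z `^ g + 6 * g * z) => x x0.
  have z01 : 0 < z <= 1 by rewrite z0.
  have := bracket_le g01 x0 z01.
  by rewrite (tauE (_ : 0 <= z <= 1)) ?(ltW z0)//; nra.
(* Beyond 1 the first term vanishes at [z] and is nonnegative everywhere, so the tangent of
   [3 g t^2] suffices. *)
exists (6 * g * z) => x x0; rewrite (tau_ge1 (ltW z1)) powR1 subrr mulr0 add0r.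
have /andP[P0 P1] := powR_tau_bounds x g0.
have : 0 <= x ^+ 2 * (1 - tau x `^ g) by rewrite mulr_ge0 ?sqr_ge0 ?subr_ge0.
have : 0 <= g * (x - z) ^+ 2 by rewrite mulr_ge0 ?sqr_ge0// ltW.
by nra.
Qed.

(* [al k] outgrows the sum of its predecessors, and [ga] decays so fast that the scales
   beyond [k] are negligible at the point [tk k] where [tau t ^ ga k = 1/2]. *)
Definition al k : R := k.+1`!%:R.
Definition ga k : R := \prod_(j < k.+1) (2 ^+ (j + 3) * al j)^-1.

Lemma al_ge1 k : 1 <= al k.
Proof. by rewrite ler1n fact_gt0. Qed.

Lemma al_gt0 k : 0 < al k.
Proof. exact: lt_le_trans (al_ge1 k). Qed.

Lemma ga_gt0 k : 0 < ga k.
Proof.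
by apply: prodr_gt0 => j _; rewrite invr_gt0 mulr_gt0 ?al_gt0// exprn_gt0.
Qed.

Lemma gaS k : al k.+1 * ga k.+1 = ga k / 2 ^+ (k.+1 + 3).
Proof.
rewrite /ga big_ord_recr/= invfM.
rewrite mulrC -!mulrA; congr (_ * _); rewrite mulVf ?mulr1//.
by rewrite gt_eqF// al_gt0.
Qed.

Lemma exp2_ge1 n : 1 <= 2 ^+ n :> R.
Proof. by rewrite exprn_ege1// ler1n. Qed.

Lemma ga_decr k i : (k <= i)%N -> ga i <= ga k.
Proof.
move=> /subnKC <-; elim: (i - k)%N => [|d IH]; first by rewrite addn0.
rewrite addnS; apply: le_trans IH.
have := gaS (k + d); move: (ga_gt0 (k + d).+1) (ga_gt0 (k + d)) (al_ge1 (k + d).+1).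
move=> g1 g2 a1 h.
apply: (@le_trans _ _ (al (k + d).+1 * ga (k + d).+1)).
  by rewrite ler_peMl// ltW.
by rewrite h ler_piMr ?(ltW g2)// invf_le1// ?exp2_ge1// exprn_gt0.
Qed.

Lemma ga_le1 k : ga k <= 1.
Proof.
apply: le_trans (ga_decr (leq0n k)) _; rewrite /ga big_ord1/= invf_le1.
  by rewrite mulr_ege1 ?exp2_ge1 ?al_ge1.
by rewrite mulr_gt0 ?al_gt0// exprn_gt0.
Qed.

Lemma ga01 k : 0 < ga k <= 1.
Proof. by rewrite ga_gt0 ga_le1. Qed.

Lemma alga_le k i : (k < i)%N -> al i * ga i <= ga k / 2 ^+ (i + 3).
Proof.
case: i => // i ki; rewrite gaS ler_pM2r ?invr_gt0 ?exprn_gt0//.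
exact: ga_decr.
Qed.

Lemma alga_le1 i : al i * ga i <= 1 / 2 ^+ (i + 3).
Proof.
case: i => [|i].
  rewrite /ga big_ord1 /= invfM mulrCA divff ?mulr1 ?div1r//.
  by rewrite gt_eqF// al_gt0.
by rewrite gaS ler_pM2r ?invr_gt0 ?exprn_gt0// ga_le1.
Qed.

Lemma sum_exp2_le n : \sum_(i < n) (1 / 2 ^+ (i + 3) : R) <= 1 / 4.
Proof.
suff -> : \sum_(i < n) (1 / 2 ^+ (i + 3) : R) = 1 / 4 - 1 / 2 ^+ (n + 2).
  by rewrite lerBlDr lerDl divr_ge0// exprn_ge0.
elim: n => [|n IH]; first by rewrite big_ord0 add0n; field.
rewrite big_ord_recr/= IH !addnS !addn0 !exprS.
by field; rewrite expf_neq0.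
Qed.

Definition psi k t : R := al k * (1 - tau t `^ ga k).

Lemma psi_ge0 k t : 0 <= psi k t.
Proof.
have /andP[_ h] := powR_tau_bounds t (ga_gt0 k).
by rewrite mulr_ge0 ?subr_ge0// ltW// al_gt0.
Qed.

Lemma psi_le_al k t : psi k t <= al k.
Proof.
have /andP[h _] := powR_tau_bounds t (ga_gt0 k).
by rewrite ler_piMr ?(ltW (al_gt0 k))// lerBlDr lerDl.
Qed.

Lemma psi_anti k s t : `|s| <= `|t| -> psi k t <= psi k s.
Proof.
move=> st; rewrite ler_wpM2l ?(ltW (al_gt0 k))// lerD2l lerN2.
apply: ge0_ler_powR; rewrite ?nnegrE ?tau_ge0 ?(ltW (ga_gt0 k))//.
exact: tau_le.
Qed.

(** This is [1 - p q <= (1 - p) + (1 - q)] for [p], [q] in [0, 1]. *)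
Lemma psiM k s t : `|s| <= 1 -> `|t| <= 1 -> psi k (s * t) <= psi k s + psi k t.
Proof.
move=> s1 t1; rewrite /psi -mulrDr ler_wpM2l ?(ltW (al_gt0 k))//.
have -> : tau (s * t) = tau s * tau t.
  by rewrite /tau normrM !min_r// mulr_ile1.
rewrite powRM ?tau_ge0//.
have /andP[? ?] := powR_tau_bounds s (ga_gt0 k).
have /andP[? ?] := powR_tau_bounds t (ga_gt0 k).
by nra.
Qed.

Lemma psi1 k : psi k 1 = 0.
Proof. by rewrite /psi tau_ge1// powR1 subrr mulr0. Qed.

Lemma psi_le_ln k t : t != 0 -> psi k t <= al k * ga k * - ln (tau t).
Proof.
move=> t0; rewrite /psi -mulrA ler_wpM2l ?(ltW (al_gt0 k))//.
rewrite /powR gt_eqF ?tau_gt0//.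
have := expR_ge1Dx (ga k * ln (tau t)); lra.
Qed.

(** At [t = 0] the partial sums can be unbounded, and [sup] then takes its default value 0; hence
    the recurring hypothesis [t != 0]. *)
Definition hsn S t n : R := \sum_(k < n) (if S k then psi k t else 0).
Definition hs S t : R := sup (range (hsn S t)).

Let term_ge0 S k t : 0 <= (if S k then psi k t else 0).
Proof. by case: ifP => // _; exact: psi_ge0. Qed.

Let term_le S k t : (if S k then psi k t else 0) <= psi k t.
Proof. by case: ifP => // _; exact: psi_ge0. Qed.

Lemma neg_ln_tau_ge0 t : t != 0 -> 0 <= - ln (tau t).
Proof. by move=> t0; rewrite oppr_ge0 ln_le0// tau_le1. Qed.

Lemma hsn_ub S t n : t != 0 -> hsn S t n <= - ln (tau t).
Proof.
move=> t0; have l0 := neg_ln_tau_ge0 t0.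
apply: (@le_trans _ _ (\sum_(k < n) (1 / 2 ^+ (k + 3)) * - ln (tau t))).
  apply: ler_sum => k _; apply: le_trans (term_le _ _ _) _.
  by apply: le_trans (psi_le_ln k t0) _; rewrite ler_wpM2r// alga_le1.
by rewrite -mulr_suml ler_piMl// (le_trans (sum_exp2_le n))//; lra.
Qed.

Lemma hs_has_sup S t : t != 0 -> has_sup (range (hsn S t)).
Proof.
move=> t0; split; first by exists (hsn S t 0), 0%N.
by exists (- ln (tau t)) => _ [n _ <-]; exact: hsn_ub.
Qed.

Lemma hsn_le_hs S t n : t != 0 -> hsn S t n <= hs S t.
Proof.
by move=> /(hs_has_sup S)[_ h]; apply: ub_le_sup => //; exists n.
Qed.

Lemma hs_le S t c : (forall n, hsn S t n <= c) -> hs S t <= c.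
Proof.
move=> h; apply: ge_sup; first by exists (hsn S t 0), 0%N.
by move=> _ [n _ <-].
Qed.

Lemma hsn_ge0 S t n : 0 <= hsn S t n.
Proof. by apply: sumr_ge0 => k _; exact: term_ge0. Qed.

Lemma hs_ge0 S t : 0 <= hs S t.
Proof.
have [t0|t0] := pselect (has_sup (range (hsn S t))); last by rewrite /hs sup_out.
apply: (@le_trans _ _ (hsn S t 0)); first exact: hsn_ge0.
by apply: ub_le_sup; [exact: t0.2|exists 0%N].
Qed.

Lemma hs_sub S S' t : t != 0 -> (forall k, S k -> S' k) -> hs S t <= hs S' t.
Proof.
move=> t0 SS'; apply: hs_le => n; apply: le_trans (hsn_le_hs S' n t0).
apply: ler_sum => k _; case: ifP => [/SS' -> //|_]; exact: term_ge0.
Qed.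

Lemma hsU S S1 S2 t : t != 0 -> (forall k, S k -> S1 k || S2 k) ->
  hs S t <= hs S1 t + hs S2 t.
Proof.
move=> t0 SS; apply: hs_le => n.
apply: (@le_trans _ _ (hsn S1 t n + hsn S2 t n)); last by rewrite lerD ?hsn_le_hs.
rewrite /hsn -big_split/=; apply: ler_sum => k _.
case: ifP => [/SS/orP[->|->]|_]; rewrite ?lerDl ?lerDr ?addr_ge0//; exact: term_ge0.
Qed.

Lemma hsM S s t : s != 0 -> t != 0 -> `|s| <= 1 -> `|t| <= 1 ->
  hs S (s * t) <= hs S s + hs S t.
Proof.
move=> s0 t0 s1 t1; apply: hs_le => n.
apply: (@le_trans _ _ (hsn S s n + hsn S t n)); last by rewrite lerD ?hsn_le_hs.
rewrite /hsn -big_split/=; apply: ler_sum => k _.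
by case: ifP => _; rewrite ?addr0// psiM.
Qed.

Lemma hs_anti S s t : s != 0 -> `|s| <= `|t| -> hs S t <= hs S s.
Proof.
move=> s0 st; apply: hs_le => n; apply: le_trans (hsn_le_hs S n s0).
by apply: ler_sum => k _; case: ifP => // _; exact: psi_anti.
Qed.

Lemma hs_norm S t : hs S `|t| = hs S t.
Proof.
have E : hsn S `|t| = hsn S t.
  by apply/funext => n; apply: eq_bigr => k _; rewrite /psi tau_norm.
by rewrite /hs E.
Qed.

Lemma hs1 S : hs S 1 = 0.
Proof.
apply/eqP; rewrite eq_le hs_ge0 andbT; apply: hs_le => n.
by rewrite /hsn big1// => k _; rewrite psi1; case: ifP.
Qed.

Lemma hs_eq0 S t : (forall k, ~~ S k) -> hs S t = 0.
Proof.
move=> S0; apply/eqP; rewrite eq_le hs_ge0 andbT; apply: hs_le => n.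
by rewrite /hsn big1// => k _; rewrite (negPf (S0 k)).
Qed.

Lemma psi_le_hs S k t : t != 0 -> S k -> psi k t <= hs S t.
Proof.
move=> t0 Sk; apply: le_trans (hsn_le_hs S k.+1 t0).
rewrite /hsn big_ord_recr/= Sk lerDr; exact: hsn_ge0.
Qed.

Definition tk k : R := (1 / 2) `^ (ga k)^-1.

Lemma tk_gt0 k : 0 < tk k. Proof. by rewrite powR_gt0. Qed.

Lemma tk_le1 k : tk k <= 1.
Proof.
have := @ge0_ler_powR _ (ga k)^-1 _ (1 / 2) 1; rewrite powR1; apply.
- by rewrite invr_ge0 ltW// ga_gt0.
- by rewrite nnegrE.
- by rewrite nnegrE.
by lra.
Qed.

Lemma psi_tk k : psi k (tk k) = al k / 2.
Proof.
rewrite /psi tauE; last by rewrite (ltW (tk_gt0 k)) tk_le1.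
rewrite /tk -powRrM mulVf ?gt_eqF ?ga_gt0// powRr1//.
by field.
Qed.

(** The logarithmic bound at [tk k] carries the factor [al i * ga i / ga k], which the decay of [ga]
    makes tiny. *)
Lemma psi_tk_gt k i : (k < i)%N -> psi i (tk k) <= 1 / 2 ^+ (i + 3).
Proof.
move=> ki; have tk0 : tk k != 0 by rewrite gt_eqF// tk_gt0.
apply: le_trans (psi_le_ln i tk0) _.
rewrite tauE; last by rewrite (ltW (tk_gt0 k)) tk_le1.
rewrite /tk ln_powR.
have l2 : - ln (1 / 2 : R) <= 1.
  rewrite -lnV ?posrE// div1r invrK.
  by have := @le_ln1Dx R 1; rewrite -[1 + 1]/(2%:R); apply; lra.
have l0 : 0 <= - ln (1 / 2 : R) by rewrite oppr_ge0 ln_le0//; lra.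
apply: (@le_trans _ _ (ga k / 2 ^+ (i + 3) * - ((ga k)^-1 * ln (1 / 2)))).
  apply: ler_wpM2r; last exact: alga_le.
  by rewrite -mulrN mulr_ge0// invr_ge0 ltW// ga_gt0.
have -> : ga k / 2 ^+ (i + 3) * - ((ga k)^-1 * ln (1 / 2)) =
    1 / 2 ^+ (i + 3) * - ln (1 / 2).
  by field; rewrite expf_neq0// gt_eqF// ga_gt0.
by rewrite ler_piMr// divr_ge0// exprn_ge0.
Qed.

(** The sum is at most [2 * k!], while [al k = (k + 1)!]. The quotient [k.+1] later makes the ratio
    of two Orlicz functions unbounded. *)
Lemma sum_al_le k : \sum_(i < k) al i <= 2 * al k / k.+1%:R.
Proof.
suff : \sum_(i < k) al i <= 2 * k`!%:R.
  move=> /le_trans; apply; rewrite /al factS natrM.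
  by rewrite [X in _ <= X / _]mulrCA [leRHS]mulrC mulKf// pnatr_eq0.
elim: k => [|[|k] IH]; first by rewrite big_ord0 mulr_ge0.
  by rewrite big_ord1 /al ler_peMl// ler1n.
rewrite big_ord_recr/=; apply: le_trans (lerD IH (lexx _)) _.
have : (2 * k.+1`!)%:R <= (k.+2`!)%:R :> R by rewrite ler_nat (factS k.+1) leq_mul2r orbC.
by rewrite natrM /al; lra.
Qed.

(* At [tk k] the [k]-th term dominates the sum of all the others. *)
Lemma hs_tk S k : ~~ S k -> hs S (tk k) <= 2 * al k / k.+1%:R + 1.
Proof.
move=> Sk; apply: hs_le => n.
have tk0 : tk k != 0 by rewrite gt_eqF// tk_gt0.
apply: (@le_trans _ _ (\sum_(i < n | (i < k)%N) al i +
    \sum_(i < n) (1 / 2 ^+ (i + 3)))).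
  rewrite /hsn (big_mkcond (fun i : 'I_n => (i < k)%N)) -big_split/=.
  apply: ler_sum => i _.
  have e0 : 0 <= 1 / 2 ^+ (i + 3) :> R by rewrite divr_ge0// exprn_ge0.
  case: (ltngtP i k) => ik.
  - apply: le_trans (term_le _ _ _) _; apply: le_trans (psi_le_al _ _) _.
    by rewrite lerDl.
  - by rewrite add0r; apply: le_trans (term_le _ _ _) _; exact: psi_tk_gt.
  by rewrite ik (negPf Sk) add0r -ik.
rewrite lerD//; last by apply: le_trans (sum_exp2_le n) _; lra.
apply: le_trans (sum_al_le k).
have h0 m : 0 <= al m by rewrite ltW// al_gt0.
rewrite (big_mkcond (fun i : 'I_n => (i < k)%N))/=.
rewrite -(big_mkord xpredT (fun i => if (i < k)%N then al i else 0)).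
rewrite -(big_mkord xpredT al).
apply: (@le_trans _ _ (\sum_(0 <= i < maxn n k) (if (i < k)%N then al i else 0))).
  rewrite [leRHS](big_cat_nat (n := n)) ?leq_maxl//= lerDl.
  by apply: sumr_ge0 => i _; case: ifP.
rewrite (big_cat_nat (n := k)) ?leq_maxr//= [X in _ + X <= _]big_nat.
rewrite [X in _ + X <= _]big1 ?addr0 => [|i /andP[ki _]]; last first.
  by rewrite ltnNge ki.
by apply: ler_sum_nat => i /andP[_ ->].
Qed.


Local Opaque hs.

(* The Orlicz function attached to a set [S] of active scales; the factor [c] makes
   it close to [t^2] without changing its equivalence class. *)
Definition ow S c t : R := t ^+ 2 * (1 + c * hs S t).

(** * Convexity and growth of the Orlicz functions *)

Section Weight.
Variables (S : pred nat) (c : R).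
Hypothesis c01 : 0 <= c <= 1.

Let c0 : 0 <= c. Proof. by case/andP: c01. Qed.

Lemma ow_factor_ge1 t : 1 <= 1 + c * hs S t.
Proof. by rewrite lerDl mulr_ge0// hs_ge0. Qed.

Lemma ow0 : ow S c 0 = 0. Proof. by rewrite /ow expr0n mul0r. Qed.

Lemma ow1 : ow S c 1 = 1. Proof. by rewrite /ow hs1 mulr0 addr0 expr1n mulr1. Qed.

Lemma ow_norm t : ow S c `|t| = ow S c t.
Proof.
by rewrite /ow hs_norm real_normK// num_real.
Qed.

Lemma ow_ge0 t : 0 <= ow S c t.
Proof. by rewrite mulr_ge0 ?sqr_ge0// (le_trans ler01)// ow_factor_ge1. Qed.

(** With [ow_ge], this presents [ow] as the supremum of its partial sums, so that convexity need
    only be shown for finite sums. *)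
Lemma ow_le t b : (forall n, t ^+ 2 * (1 + c * hsn S t n) <= b) -> ow S c t <= b.
Proof.
have [->|t0] := eqVneq t 0.
  by move=> /(_ 0%N); rewrite ow0 expr0n mul0r.
have [->|cn0] := eqVneq c 0.
  by move=> /(_ 0%N); rewrite /ow !mul0r.
move=> h.
have t2 : 0 < t ^+ 2 by rewrite exprn_even_gt0.
have cp : 0 < c by rewrite lt_neqAle eq_sym cn0.
rewrite /ow -ler_pdivlMl// -lerBrDl -ler_pdivlMl//; apply: hs_le => n.
by rewrite ler_pdivlMl// lerBrDl ler_pdivlMl.
Qed.

Lemma ow_ge t n : t ^+ 2 * (1 + c * hsn S t n) <= ow S c t.
Proof.
have [->|t0] := eqVneq t 0; first by rewrite ow0 expr0n mul0r.
by rewrite ler_wpM2l ?sqr_ge0// lerD2l ler_wpM2l// hsn_le_hs.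
Qed.

(** The function is a nonnegative multiple of [t^2] plus a nonnegative combination of the convex
    functions of [sqr_powR_tangent]; the corrections [3 * ga k] cost at most 3/4 of the [t^2]
    term. *)
Let ow_tangent n z : 0 < z -> exists m, forall x, 0 <= x ->
  z ^+ 2 * (1 + c * hsn S z n) + m * (x - z) <= x ^+ 2 * (1 + c * hsn S x n).
Proof.
move=> z0.
pose w k : R := if S k then c * al k else 0.
have w0 k : 0 <= w k by rewrite /w; case: ifP => // _; rewrite mulr_ge0// ltW// al_gt0.
have E x : x ^+ 2 * (1 + c * hsn S x n) =
    (1 - \sum_(k < n) w k * (3 * ga k)) * x ^+ 2 +
    \sum_(k < n) w k * (x ^+ 2 * (1 - tau x `^ ga k) + 3 * ga k * x ^+ 2).
  rewrite mulrBl mul1r mulr_suml -addrA -sumrN -big_split/= mulrDr mulr1 mulrA.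
  congr (_ + _); rewrite /hsn mulr_sumr; apply: eq_bigr => k _.
  by rewrite /w /psi; case: ifP => _; ring.
have W1 : \sum_(k < n) w k * (3 * ga k) <= 1.
  apply: (@le_trans _ _ (\sum_(k < n) 3 * (1 / 2 ^+ (k + 3)))).
    apply: ler_sum => k _; rewrite mulrCA ler_wpM2l//.
    apply: le_trans (alga_le1 k); rewrite ler_wpM2r ?(ltW (ga_gt0 k))//.
    have a0 := ltW (al_gt0 k).
    by rewrite /w; case: ifP => // _; rewrite ler_piMl//; case/andP: c01.
  by rewrite -mulr_sumr; have := sum_exp2_le n; lra.
have /boolp.choice[m hm] k := sqr_powR_tangent (ga01 k) z0.
exists ((1 - \sum_(k < n) w k * (3 * ga k)) * (2 * z) + \sum_(k < n) w k * m k).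
rewrite -subr_ge0 in W1; move: W1 E; set A := 1 - _ => A0 E.
move=> x x0; rewrite !E [X in _ + X <= _]mulrDl addrACA [X in _ + (_ + X) <= _]mulr_suml.
rewrite -big_split/=; apply: lerD.
  by have := mulr_ge0 A0 (sqr_ge0 (x - z)); nra.
apply: ler_sum => k _; have := ler_wpM2l (w0 k) (hm k x x0).
by rewrite [leLHS]mulrDr (mulrA _ (m k)).
Qed.

(** In the tangent at the convex combination [z], the linear terms cancel. *)
Let ow_convex_ge0 a s t : 0 <= a <= 1 -> 0 <= s -> 0 <= t ->
  ow S c (a * s + (1 - a) * t) <= a * ow S c s + (1 - a) * ow S c t.
Proof.
move=> /andP[a0 a1] s0 t0; set z := _ + _.
have b0 : 0 <= 1 - a by rewrite subr_ge0.
have z0 : 0 <= z by rewrite addr_ge0 ?mulr_ge0.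
have [->|zn0] := eqVneq z 0.
  by rewrite ow0; apply: addr_ge0; apply: mulr_ge0 => //; exact: ow_ge0.
have zp : 0 < z by rewrite lt_neqAle eq_sym zn0.
apply: ow_le => n; have [m hm] := ow_tangent n zp.
have hs' := ler_wpM2l a0 (le_trans (hm s s0) (ow_ge s n)).
have ht' := ler_wpM2l b0 (le_trans (hm t t0) (ow_ge t n)).
apply: le_trans (lerD hs' ht').
rewrite le_eqVlt; apply/orP; left; apply/eqP; rewrite /z; ring.
Qed.

Let ow_mono s t : 0 <= s <= t -> ow S c s <= ow S c t.
Proof.
move=> /andP[s0 st]; have [t0|t0] := eqVneq t 0.
  by have -> : s = t by apply/eqP; rewrite eq_le st t0.
have tp : 0 < t by rewrite lt_neqAle eq_sym t0 (le_trans s0).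
have a01 : 0 <= s / t <= 1.
  by rewrite divr_ge0 ?(ltW tp)//= ler_pdivrMr// mul1r.
have := ow_convex_ge0 a01 (ltW tp) (lexx 0).
have -> : s / t * t + (1 - s / t) * 0 = s by field.
rewrite ow0 [_ * 0]mulr0 [_ + 0]addr0 => /le_trans; apply.
by case/andP: a01 => _ h; apply: ler_piMl => //; exact: ow_ge0.
Qed.

Lemma ow_convex a s t : 0 <= a <= 1 ->
  ow S c (a * s + (1 - a) * t) <= a * ow S c s + (1 - a) * ow S c t.
Proof.
move=> /[dup] a01 /andP[a0 a1].
rewrite -ow_norm -(ow_norm s) -(ow_norm t).
apply: le_trans (ow_convex_ge0 a01 (normr_ge0 s) (normr_ge0 t)).
apply: ow_mono; rewrite normr_ge0/=.
apply: le_trans (ler_normD _ _) _; rewrite !normrM (ger0_norm a0).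
by rewrite (@ger0_norm _ (1 - a))// subr_ge0.
Qed.

Lemma ow_quad b t : 1 <= b -> ow S c (b * t) <= b ^+ 2 * ow S c t.
Proof.
move=> b1; have [->|t0] := eqVneq t 0; first by rewrite mulr0 ow0 mulr0.
rewrite /ow exprMn -mulrA; apply: ler_wpM2l; first exact: sqr_ge0.
apply: ler_wpM2l; first exact: sqr_ge0.
rewrite lerD2l; apply: ler_wpM2l => //; apply: hs_anti => //.
rewrite normrM; apply: ler_peMl; first exact: normr_ge0.
exact: le_trans b1 (ler_norm b).
Qed.

Let factor_leM (a b d : R) : d <= a + b -> 0 <= a * b -> 1 + d <= (1 + a) * (1 + b).
Proof. by move: c c01 c0 => _ _ _; nra. Qed.

Let factor_leM2 (a b d : R) : a <= 1 + b -> d <= a + b -> 1 + d <= 2 * (1 + b).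
Proof. by move: c c01 c0 => _ _ _; lra. Qed.

(** Subadditivity of [hs] becomes submultiplicativity through [1 + u + v <= (1 + u) * (1 + v)]. *)
Lemma owM s t : `|s| <= 1 -> `|t| <= 1 -> ow S c (s * t) <= ow S c s * ow S c t.
Proof.
move=> s1 t1; have [->|s0] := eqVneq s 0; first by rewrite mul0r ow0 mul0r.
have [->|t0] := eqVneq t 0; first by rewrite mulr0 ow0 mulr0.
rewrite /ow exprMn [leRHS]mulrACA; apply: ler_wpM2l.
  by apply: mulr_ge0; exact: sqr_ge0.
have := ler_wpM2l c0 (hsM S s0 t0 s1 t1); rewrite mulrDr => h1.
have h2 := mulr_ge0 (mulr_ge0 c0 (hs_ge0 S s)) (mulr_ge0 c0 (hs_ge0 S t)).
exact: factor_leM.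
Qed.

(* The hypothesis holds if [`|t| <= `|s|], or if [c] is small with respect to [s]. *)
Lemma owM2 s t : `|s| <= 1 -> `|t| <= 1 -> s != 0 -> t != 0 ->
  c * hs S s <= 1 + c * hs S t -> ow S c (s * t) <= 2 * s ^+ 2 * ow S c t.
Proof.
move=> s1 t1 s0 t0 h.
have -> : 2 * s ^+ 2 * ow S c t = s ^+ 2 * t ^+ 2 * (2 * (1 + c * hs S t)).
  by rewrite /ow; ring.
rewrite /ow exprMn; apply: ler_wpM2l; first by apply: mulr_ge0; exact: sqr_ge0.
have := ler_wpM2l c0 (hsM S s0 t0 s1 t1); rewrite mulrDr => h1.
exact: factor_leM2 h h1.
Qed.

End Weight.

Lemma hs_exp2 S n : hs S (2 ^- n) <= n%:R * hs S (2^-1).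
Proof.
elim: n => [|n IH]; first by rewrite expr0 invr1 hs1 mul0r.
rewrite exprS invfM -[n.+1%:R]natr1 mulrDl mul1r addrC.
apply: le_trans (hsM _ _ _ _ _) _; last by rewrite lerD2l.
- by rewrite invr_neq0.
- by rewrite invr_neq0// expf_neq0.
- by rewrite ger0_norm ?invr_ge0// invf_le1// ler1n.
by rewrite ger0_norm ?invr_ge0 ?exprn_ge0// invf_le1 ?exprn_gt0// exp2_ge1.
Qed.

(** Submultiplicativity reduces the claim to [t = 1], where the value at [1 / N] is [N ^- 2] times a
    factor at most logarithmic in [N]. Comparison with the full set [predT] makes [N] independent of
    [S] and [c]. *)
Lemma ow_small e : 0 < e -> exists2 N : nat, (0 < N)%N &
  forall S c t, 0 <= c <= 1 -> `|t| <= 1 -> ow S c (t / N%:R) <= e / N%:R * ow S c t.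
Proof.
move=> e0; pose H := hs predT (2^-1).
have H0 : 0 <= H by exact: hs_ge0.
(* Large enough for [1 + 2 * m * H <= m ^ 2 * e], while [m ^ 2 <= N]. *)
pose m := (Num.truncn ((1 + 2 * H) / e)).+1.
exists (2 ^ (2 * m))%N; first by rewrite expn_gt0.
move=> S c t c01 t1; have /andP[c0 c1] := c01.
rewrite natrX; set N := 2 ^+ (2 * m) : R.
have N0 : 0 < N by rewrite exprn_gt0.
have N1 : 1 <= N by exact: exp2_ge1.
have NV : `|N^-1| <= 1 by rewrite ger0_norm ?invr_ge0 ?(ltW N0)// invf_le1.
rewrite mulrC; apply: le_trans (owM S c01 NV t1) _.
rewrite ler_wpM2r ?ow_ge0//.
rewrite /ow expr2 -mulrA mulrC ler_pM2r ?invr_gt0//.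
rewrite mulrC ler_pdivrMr//.
have hN : hs S N^-1 <= (2 * m)%:R * H.
  apply: le_trans (hs_exp2 _ _) _; rewrite ler_wpM2l//.
  by apply: hs_sub => //; rewrite invr_neq0.
have m1 : (1 + 2 * H) / e <= m%:R by rewrite ltW// truncnS_gt.
rewrite ler_pdivrMr// in m1.
have mN : m%:R * m%:R <= N.
  have h : m%:R <= 2 ^+ m :> R by rewrite -natrX ler_nat ltnW// ltn_expl.
  by rewrite /N mul2n -addnn exprD ler_pM.
have m1' : 1 <= m%:R :> R by rewrite ler1n.
apply: (@le_trans _ _ (m%:R * (m%:R * e))); last first.
  by rewrite mulrA mulrC ler_wpM2l// ltW.
apply: (@le_trans _ _ (m%:R * (1 + 2 * H))); last by rewrite ler_wpM2l.
have : c * hs S N^-1 <= hs S N^-1 by rewrite ler_piMl// hs_ge0.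
by move: hN; rewrite natrM; nra.
Qed.

End ScaleFunctions.

(** * Unit vectors and disjoint sums *)

Section DisjointSums.
Variables (R : realType) (F : orlicz_family R).
Local Notation X := (orlicz F).

Lemma orho_sum_disjoint n (u : nat -> nat -> R) N :
  (forall i i' j, (i < i' < n)%N -> u i j = 0 \/ u i' j = 0) ->
  orho F (fun j => \sum_(i < n) u i j) N = \sum_(i < n) orho F (u i) N.
Proof.
move=> hu; rewrite /orho exchange_big/=; apply: eq_bigr => j _.
elim: n hu => [|n IH] hu; first by rewrite !big_ord0 ofun0.
rewrite !big_ord_recr/= -IH => [|i i' j' /andP[ii' i'n]]; last first.
  by apply: hu; rewrite ii' ltnW.
have [un|un] := eqVneq (u n j) 0; first by rewrite un ofun0 !addr0.
rewrite big1 ?add0r ?ofun0 ?add0r// => i _.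
by case: (hu i n j) => // [|/eqP]; [rewrite ltn_ord leqnn|rewrite (negPf un)].
Qed.

Lemma orho_single m a N :
  orho F (fun j => a * (m == j)%:R) N = if (m < N)%N then F m a else 0.
Proof.
rewrite /orho; case: ltnP => mN.
  rewrite (bigD1 (Ordinal mN))//= eqxx mulr1 big1 ?addr0// => j.
  by rewrite eq_sym -val_eqE/= => /negPf ->; rewrite mulr0 ofun0.
rewrite big1// => j _; rewrite gtn_eqF ?mulr0 ?ofun0//.
exact: leq_trans (ltn_ord j) mN.
Qed.

Lemma norm_units_leP n (a : nat -> R) (m : nat -> nat) c : 0 < c ->
  (forall i i', (i < i' < n)%N -> m i != m i') ->
  `|\sum_(i < n) a i *: ounit F (m i)| <= c <->
  \sum_(i < n) F (m i) (a i / c) <= 1.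
Proof.
move=> c0 minj.
have E N : orho F (fun j => (\sum_(i < n) a i *: ounit F (m i)) j / c) N =
    \sum_(i < n) (if (m i < N)%N then F (m i) (a i / c) else 0).
  transitivity (\sum_(i < n) orho F (fun j => a i / c * (m i == j)%:R) N); last first.
    by apply: eq_bigr => i _; exact: orho_single.
  rewrite -(orho_sum_disjoint (u := fun i j => a i / c * (m i == j)%:R)).
    congr (orho F _ N); apply/funext => j.
    rewrite oval_sum mulr_suml; apply: eq_bigr => i _.
    by rewrite ovalZ ounitE mulrAC.
  move=> i i' j /minj mi; case: (eqVneq (m i) j) => [mij|]; last by left; rewrite mulr0.
  by right; rewrite eq_sym -mij (negPf mi) mulr0.
rewrite orlicz_norm_leP//; split=> [B|B N].
  pose N := \max_(i < n) (m i).+1.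
  have := B N; rewrite E; congr (_ <= _); apply: eq_bigr => i _.
  by rewrite ifT//; exact: (leq_bigmax i).
rewrite E; apply: le_trans B; apply: ler_sum => i _.
by case: ifP => // _; exact: ofun_ge0.
Qed.

End DisjointSums.

(** The levels [c] are kept positive because the modular criteria for the norm divide by [c]. *)
Lemma le_norm_scale (R : realType) (V W : normedModType R) (v : V) (w : W) K :
  0 <= K -> (forall c, 0 < c -> `|w| <= c -> `|v| <= K * c) -> `|v| <= K * `|w|.
Proof.
move=> K0 h; apply/ler_addgt0Pr => e e0.
have K1 : 0 < K + 1 by rewrite ltr_wpDl.
have d0 : 0 < e / (K + 1) by rewrite divr_gt0.
apply: le_trans (h (`|w| + e / (K + 1)) _ _) _.
- by rewrite ltr_wpDl.
- by rewrite lerDl ltW.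
rewrite mulrDr lerD2l mulrCA ler_piMr ?(ltW e0)//.
by rewrite ler_pdivrMr// mul1r lerDl.
Qed.

(** * Subsequences of the unit vectors *)

Section UnitSequences.
Variables (F : orlicz_family RR) (m : nat -> nat).
Hypothesis mmono : forall i i', (i < i')%N -> (m i < m i')%N.
Local Notation X := (orlicz F).

Let mid i : (i <= m i)%N.
Proof.
elim: i => // i IH; exact: leq_ltn_trans IH (mmono (ltnSn i)).
Qed.

Let minj i i' : m i = m i' -> i = i'.
Proof.
by move=> mm; case: (ltngtP i i') => // /mmono; rewrite mm ltnn.
Qed.

Lemma units_normalized : normalized (fun i => ounit F (m i)).
Proof. by move=> i; exact: norm_ounit. Qed.

Lemma units_weakly_null : weakly_null (fun i => ounit F (m i)).
Proof. by move=> f df; exact: orlicz_unit_cvg0. Qed.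

Let units_sumE n (a : nat -> RR) j :
  (\sum_(i < n) a i *: ounit F (m i)) j = \sum_(i < n) a i * (m i == j)%:R.
Proof. by rewrite oval_sum; apply: eq_bigr => i _; rewrite ovalZ ounitE. Qed.

Let units_coord n (a : nat -> RR) i : (i < n)%N ->
  (\sum_(i < n) a i *: ounit F (m i)) (m i) = a i.
Proof.
move=> ni; rewrite units_sumE (bigD1 (Ordinal ni))//= eqxx mulr1 big1 ?addr0// => k.
rewrite -val_eqE/= => ki; rewrite (_ : m k == m i = false) ?mulr0//.
by apply/negP => /eqP/minj/eqP; rewrite (negPf ki).
Qed.

Lemma units_basic : basic_seq (fun i => ounit F (m i)).
Proof.
move=> y cy.
(* Coordinates are continuous, so a vector in the closed span vanishes off the range of [m]. *)
have y0 j : (forall i, m i != j) -> y j = 0.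
  move=> jm; apply/eqP; rewrite -normr_le0; apply/ler_addgt0Pr => e e0; rewrite add0r.
  have [z [[n [a zE]]]] := cy _ (nbhsx_ballx y e e0).
  rewrite -ball_normE/= => /ltW; apply: le_trans.
  apply: le_trans (oval_le_norm _ j); rewrite ovalB zE units_sumE big1 ?subr0//.
  by move=> i _; rewrite (negPf (jm i)) mulr0.
exists (fun i => y (m i)); split.
  (* The remainder after [N] terms lives on coordinates from [m N] on, so a tail of [y] bounds
     it. *)
  apply/cvgrPdist_le => e e0; have [n hn] := otail_small y e0.
  exists n => // N /= nN; apply: le_trans (hn (m N) _); last exact: leq_trans nN _.
  apply: norm_le_pointwise => j; rewrite ovalB oprojE.
  have [[i /eqP mi]|jm] := pselect (exists i, m i == j); last first.
    have jm' i : m i != j by apply/negP => h; apply: jm; exists i.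
    rewrite y0// (units_sumE N (fun i => y (m i))) big1 ?subr0 ?if_same// => i _.
    by rewrite (negPf (jm' i)) mulr0.
  rewrite -mi; case: (ltnP i N) => iN.
    by rewrite (units_coord (fun i => y (m i)))// subrr normr0.
  rewrite (units_sumE N (fun i => y (m i))) big1 ?subr0; last first.
    move=> k _; rewrite (_ : m k == m i = false) ?mulr0//.
    by apply/negbTE; rewrite neq_ltn mmono// (leq_trans (ltn_ord k)).
  rewrite ifT//; move: iN; rewrite leq_eqVlt => /predU1P[-> //|/mmono/ltnW]//.
move=> a ay; apply/funext => i; apply/eqP; rewrite -subr_eq0 -normr_le0.
apply/ler_addgt0Pr => e e0; rewrite add0r.
have /cvgrPdist_le/(_ e e0)[n _ hn] := ay.
have := hn (maxn n i.+1) (leq_maxl _ _); apply: le_trans.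
apply: le_trans (oval_le_norm _ (m i)).
by rewrite ovalB (units_coord a)// leq_maxr.
Qed.

End UnitSequences.

(** * The space attached to a lattice *)

Local Opaque hs psi tk.

Section LatticeSpace.
Variables (d : Order.disp_t) (L : latticeType d) (f : L -> nat) (b : L).
Hypothesis finj : injective f.
Implicit Types (l : L) (t : RR).

(* Coordinate [j] carries the label numbered by the 2-adic valuation of [j + 1], so
   that every label occurs infinitely often; [pos l] enumerates the label [l]. *)
Definition lab (j : nat) : L :=
  if pselect (exists l, f l = logn 2 j.+1) is left h then projT1 (cid h) else b.

Definition pos l i : nat := (2 ^ f l * (2 * i).+1).-1.

Lemma posS l i : (pos l i).+1 = (2 ^ f l * (2 * i).+1)%N.
Proof. by rewrite /pos prednK// muln_gt0 expn_gt0. Qed.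

Lemma lab_pos l i : lab (pos l i) = l.
Proof.
have E : f l = logn 2 (pos l i).+1.
  rewrite posS lognM ?expn_gt0// pfactorK// lognE/=.
  by rewrite dvdn2 /= mul2n odd_double addn0.
rewrite /lab; case: pselect => [h|]; last by case; exists l.
by apply: finj; rewrite (projT2 (cid h)).
Qed.

Lemma pos_mono l i i' : (i < i')%N -> (pos l i < pos l i')%N.
Proof.
by move=> ii'; rewrite -ltnS !posS ltn_pmul2l ?expn_gt0// ltnS ltn_pmul2l.
Qed.

Lemma pos_ge l i : (i <= pos l i)%N.
Proof.
by elim: i => // i IH; apply: leq_ltn_trans IH (pos_mono _ _).
Qed.

(** [lab] now labels the scales too, each label recurring at arbitrarily large ones. Active sets
    grow with [l], and that of a join is the union. *)
Definition active l : pred nat := fun k => ~~ (l <= lab k)%O.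
(** Tends to 0 along the enumeration, so at a fixed argument all but finitely many labels behave
    like [t^2]. *)
Definition kap l : RR := (f l).+1%:R^-1.
Definition lfun l : RR -> RR := ow (active l) (kap l).

Lemma kap01 l : 0 <= kap l <= 1.
Proof. by rewrite invr_ge0 ler0n/= invf_le1 ?ltr0n// ler1n. Qed.

Lemma kap_gt0 l : 0 < kap l. Proof. by rewrite invr_gt0 ltr0n. Qed.

Fact lfun_small e : 0 < e -> exists2 N : nat, (0 < N)%N & forall j t, `|t| <= 1 ->
  lfun (lab j) (t / N%:R) <= e / N%:R * lfun (lab j) t.
Proof.
move=> /ow_small[N N0 hN]; exists N => // j t t1.
by apply: hN => //; exact: kap01.
Qed.

Definition lfamily : orlicz_family RR :=
  OrliczFamily (fun j => ow0 (active (lab j)) (kap (lab j)))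
    (fun j => ow1 (active (lab j)) (kap (lab j)))
    (fun j => ow_norm (active (lab j)) (kap (lab j)))
    (fun j a s t => @ow_convex _ (active (lab j)) _ (kap01 (lab j)) a s t)
    (fun j a t => @ow_quad _ (active (lab j)) _ (kap01 (lab j)) a t)
    lfun_small.

Definition lspace : completeNormedModType RR := orlicz lfamily.

Definition lunit l i : lspace := ounit lfamily (pos l i).

Definition lmodel l : seqmodel := @SeqModel lspace (lunit l).

Lemma lfamilyE j t : lfamily j t = lfun (lab j) t. Proof. by []. Qed.

Lemma norm_labelled_leP l n (a : nat -> RR) (m : nat -> nat) c : 0 < c ->
  (forall i i', (i < i' < n)%N -> m i != m i') ->
  (forall i, (i < n)%N -> lab (m i) = l) ->
  `|\sum_(i < n) a i *: ounit lfamily (m i)| <= c <->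
  \sum_(i < n) lfun l (a i / c) <= 1.
Proof.
move=> c0 minj ml; rewrite norm_units_leP//.
by rewrite (eq_bigr (fun i : 'I_n => lfun l (a i / c)))// => i _; rewrite lfamilyE ml.
Qed.

Lemma norm_lunit_leP l n (a : nat -> RR) c : 0 < c ->
  `|\sum_(i < n) a i *: lunit l i| <= c <-> \sum_(i < n) lfun l (a i / c) <= 1.
Proof.
move=> c0; apply: norm_labelled_leP => //.
  by move=> i i' /andP[ii' _]; rewrite neq_ltn pos_mono.
by move=> i _; exact: lab_pos.
Qed.

(** Only the labels matter for the norm, so the unit vectors of one label are isometric to each of
    their subsequences and form their own spreading model. *)
Lemma norm_labelled l n (a : nat -> RR) (m : nat -> nat) :
  (forall i i', (i < i' < n)%N -> m i != m i') ->
  (forall i, (i < n)%N -> lab (m i) = l) ->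
  `|\sum_(i < n) a i *: ounit lfamily (m i)| = `|\sum_(i < n) a i *: lunit l i|.
Proof.
move=> minj ml; apply/eqP; rewrite eq_le; apply/andP; split.
  rewrite -[leRHS]mul1r; apply: le_norm_scale => // c c0 /(norm_lunit_leP _ _ _ c0) h.
  by rewrite mul1r; apply/(norm_labelled_leP _ c0 minj ml).
rewrite -[leRHS]mul1r; apply: le_norm_scale => // c c0.
by move=> /(norm_labelled_leP _ c0 minj ml) h; rewrite mul1r; apply/norm_lunit_leP.
Qed.

Lemma lmodel_in_SPw l : in_SPw lspace (lmodel l).
Proof.
have pm := @pos_mono l.
exists (lunit l); split; first exact: units_normalized.
split; first exact: (@units_weakly_null lfamily (pos l) pm).
split; first exact: (@units_basic lfamily (pos l) pm).
exists (fun=> 0); split => //; split; first exact: cvg_cst.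
move=> n a k _ kmono _; rewrite addr0 invr1 !mul1r.
rewrite (@norm_labelled l n a (fun i => pos l (k i)))//.
  by move=> i i' /andP[ii' i'n]; rewrite neq_ltn pos_mono//; exact: kmono.
by move=> i _; exact: lab_pos.
Qed.

Lemma lfun_ge0 l t : 0 <= lfun l t. Proof. exact: ow_ge0 (kap01 l) _. Qed.

(** The factor undoes the weights [kap]; up to constants only the active sets count. *)
Lemma lfun_le_of_hs l l1 l2 t : t != 0 ->
  (forall k, active l k -> active l1 k || active l2 k) ->
  lfun l t <= ((f l1).+1 + (f l2).+1)%:R * (lfun l1 t + lfun l2 t).
Proof.
move=> t0 h; have hs12 := hsU t0 h.
have K l' : 1 + hs (active l') t <= (f l').+1%:R * (1 + kap l' * hs (active l') t).
  rewrite mulrDr mulr1 mulrA /kap mulfV ?pnatr_eq0// mul1r lerD2r.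
  by rewrite ler1n.
have g1 : 0 <= 1 + kap l1 * hs (active l1) t.
  by rewrite (le_trans ler01)// (ow_factor_ge1 _ (kap01 l1)).
have g2 : 0 <= 1 + kap l2 * hs (active l2) t.
  by rewrite (le_trans ler01)// (ow_factor_ge1 _ (kap01 l2)).
rewrite /lfun /ow -mulrDr mulrCA; apply: ler_wpM2l; first exact: sqr_ge0.
have h1 : kap l * hs (active l) t <= hs (active l) t.
  by rewrite ler_piMl ?hs_ge0//; case/andP: (kap01 l).
apply: (@le_trans _ _ ((1 + hs (active l1) t) + (1 + hs (active l2) t))).
  by have := h1; have := hs12; lra.
apply: le_trans (lerD (K l1) (K l2)) _.
rewrite [X in _ <= X * _]natrD [leRHS]mulrDr.
rewrite [X in _ <= X + _]mulrDl [X in _ <= _ + X]mulrDl; apply: lerD.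
  by rewrite lerDl mulr_ge0.
by rewrite lerDr mulr_ge0.
Qed.

Lemma lfun_mono l l' t : (l <= l')%O -> lfun l t <= (f l').+1%:R * lfun l' t.
Proof.
move=> ll'; have [->|t0] := eqVneq t 0; first by rewrite /lfun !ow0 mulr0.
rewrite /lfun /ow mulrCA; apply: ler_wpM2l; first exact: sqr_ge0.
have h1 : kap l * hs (active l) t <= hs (active l) t.
  by rewrite ler_piMl ?hs_ge0//; case/andP: (kap01 l).
have h2 : hs (active l) t <= hs (active l') t.
  by apply: hs_sub => // k; apply: contra => /(le_trans ll').
rewrite mulrDr mulr1 mulrA /kap mulfV ?pnatr_eq0// mul1r.
by apply: lerD; [rewrite ler1n|exact: le_trans h1 h2].
Qed.

Lemma lfun_scale l a t : 0 <= a <= 1 -> lfun l (a * t) <= a * lfun l t.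
Proof.
move=> a01; have := @ow_convex _ (active l) _ (kap01 l) a t 0 a01.
by rewrite mulr0 addr0 ow0 mulr0 addr0.
Qed.

Lemma norm_lunit_mono l l' n (a : nat -> RR) : (l <= l')%O ->
  `|\sum_(i < n) a i *: lunit l i| <= (f l').+1%:R * `|\sum_(i < n) a i *: lunit l' i|.
Proof.
move=> ll'; apply: le_norm_scale => // c c0 /(norm_lunit_leP _ _ _ c0) h.
have K0 : 0 < (f l').+1%:R :> RR by rewrite ltr0n.
apply/norm_lunit_leP; first by rewrite mulr_gt0.
apply: le_trans h; apply: ler_sum => i _.
have -> : a i / ((f l').+1%:R * c) = (f l').+1%:R^-1 * (a i / c).
  by rewrite invfM mulrCA.
apply: le_trans (lfun_scale _ _ (kap01 l')) _.
by rewrite ler_pdivrMl// lfun_mono.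
Qed.

Lemma norm_lunit_join l1 l2 n (a : nat -> RR) :
  `|\sum_(i < n) a i *: lunit (l1 `|` l2)%O i| <=
  2 * ((f l1).+1 + (f l2).+1)%:R *
  (`|\sum_(i < n) a i *: lunit l1 i| + `|\sum_(i < n) a i *: lunit l2 i|).
Proof.
set K := ((f l1).+1 + (f l2).+1)%:R.
set v1 := \sum_(i < n) a i *: lunit l1 i; set v2 := \sum_(i < n) a i *: lunit l2 i.
have K0 : 0 < K by rewrite ltr0n.
(* The factor 2 fits the two modulars, each at most 1, into one unit ball; [K] absorbs the constant
   of [lfun_le_of_hs]. *)
have K1 : 0 <= (2 * K)^-1 <= 1.
  rewrite invr_ge0 mulr_ge0 ?(ltW K0)//= invf_le1 ?mulr_gt0//.
  by rewrite mulr_ege1// ler1n.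
have w0 : 0 <= `|v1| + `|v2| by rewrite addr_ge0.
(* The sum of the two norms is read as the norm of an element of [RR^o], so that [le_norm_scale]
   applies. *)
rewrite -(ger0_norm w0).
apply: (@le_norm_scale _ _ RR^o); first by rewrite mulr_ge0// ltW.
move=> c c0; rewrite (ger0_norm w0) => vc.
have /(norm_lunit_leP _ _ _ c0) h1 : `|v1| <= c by apply: le_trans vc; rewrite lerDl.
have /(norm_lunit_leP _ _ _ c0) h2 : `|v2| <= c by apply: le_trans vc; rewrite lerDr.
apply/norm_lunit_leP; first by rewrite !mulr_gt0.
apply: (@le_trans _ _ (\sum_(i < n) (2^-1 * (lfun l1 (a i / c) + lfun l2 (a i / c))))).
  apply: ler_sum => i _.
  have -> : a i / (2 * K * c) = (2 * K)^-1 * (a i / c) by rewrite invfM mulrCA.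
  apply: le_trans (lfun_scale _ _ K1) _.
  rewrite invfM -mulrA ler_pM2l ?invr_gt0// ler_pdivrMl//.
  have [->|t0] := eqVneq (a i / c) 0.
    by rewrite /lfun ow0 mulr_ge0 ?(ltW K0)// addr_ge0 ?lfun_ge0// ow0.
  apply: lfun_le_of_hs => // k; apply: contraR; rewrite negb_or !negbK => /andP[h h'].
  by rewrite leUx h h'.
rewrite -mulr_sumr big_split ler_pdivrMl// mulr1.
exact: le_trans (lerD h1 h2) _.
Qed.

(** With [lfun_le_tk] this separates labels at scale [k]: relative to [tk k ^+ 2], the value has
    order at least [al k] if [k] is active, and at most [al k / k] if not. *)
Lemma lfun_ge_kap l k : active l k -> kap l * (al RR k / 2) * tk RR k ^+ 2 <= lfun l (tk RR k).
Proof.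
move=> lk; have tk0 : tk RR k != 0 by rewrite gt_eqF// tk_gt0.
rewrite mulrC; apply: ler_wpM2l; first exact: sqr_ge0.
rewrite -psi_tk ler_wpDl// ler_pM2l ?kap_gt0//; exact: psi_le_hs.
Qed.

Lemma lfun_le_tk l k : ~~ active l k ->
  lfun l (tk RR k) <= tk RR k ^+ 2 * (2 * al RR k / k.+1%:R + 2).
Proof.
move=> lk; apply: ler_wpM2l; first exact: sqr_ge0.
have h := hs_tk RR lk.
have : kap l * hs (active l) (tk RR k) <= hs (active l) (tk RR k).
  by rewrite ler_piMl ?hs_ge0//; case/andP: (kap01 l).
move=> /le_trans/(_ h).
by move: (kap l * _) (2 * al RR k / k.+1%:R) => u v; lra.
Qed.

(** The test vectors have [N] equal coefficients [t = tk k], for a scale [k] labelled [l'], hence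
    active for [l] but not for [l']. Domination would bound the ratio of the two functions at [t],
    which has order at least [k]. *)
Lemma lmodel_not_dominates l l' : ~~ (l <= l')%O ->
  ~ dominates (lmodel l') (lmodel l).
Proof.
move=> ll' [C0 hC0]; pose C := `|C0| + 1.
have C1 : 1 <= C by rewrite lerDr.
have {}hC n (a : nat -> RR) :
    `|\sum_(i < n) a i *: lunit l i| <= C * `|\sum_(i < n) a i *: lunit l' i|.
  apply: le_trans (hC0 n a) _; rewrite ler_wpM2r//.
  by rewrite (le_trans (ler_norm _))// lerDl.
have Cp : 0 < C by lra.
(* The final comparison will read [k.+1 <= q]. *)
pose q := 16 * C ^+ 2 / kap l.
pose k := pos l' (Num.truncn q).+1.
have qk : q < k.+1%:R.
  apply: lt_le_trans (truncnS_gt q) _; rewrite ler_nat.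
  exact: leq_trans (pos_ge _ _) (leqnSn _).
have lk : active l k by rewrite /active lab_pos.
have l'k : ~~ active l' k by rewrite /active lab_pos lexx.
pose t := tk RR k; have t0 : 0 < t by exact: tk_gt0.
have t1 : t <= 1 by exact: tk_le1.
have [y yE] : exists y, y = lfun l' t by exists (lfun l' t).
have y0 : 0 < y.
  by rewrite yE mulr_gt0 ?exprn_gt0// (lt_le_trans ltr01)// (ow_factor_ge1 _ (kap01 l')).
have y1 : y <= 1.
  rewrite yE; have := ofun_le lfamily (pos l' 0) (s := t) (t := 1).
  rewrite ofun1 lfamilyE lab_pos; apply.
  by rewrite normr1 ger0_norm// ltW.
pose N := Num.truncn y^-1.
have yV : 1 <= y^-1 by rewrite invf_ge1.
have N1 : (0 < N)%N by rewrite truncn_gt0.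
have NR : 1 <= N%:R :> RR by rewrite ler1n.
have Ny : N%:R * y <= 1.
  by rewrite -ler_pdivlMr// mul1r truncn_le// (le_trans ler01).
have yN : 1 <= 2 * N%:R * y.
  have := truncnS_gt y^-1; rewrite -/N -[N.+1%:R]natr1 => /ltW.
  by rewrite -div1r ler_pdivrMr// => h; nra.
have hN : N%:R * lfun l (t / C) <= 1.
  have : `|\sum_(i < N) t *: lunit l i| <= C.
    apply: le_trans (hC N (fun=> t)) _; rewrite -[leRHS]mulr1 ler_pM2l//.
    apply/(norm_lunit_leP l' N (fun=> t) ltr01).
    by rewrite sumr_const card_ord divr1 -mulr_natl -yE.
  move/(norm_lunit_leP l N (fun=> t) Cp).
  by rewrite sumr_const card_ord -[X in X <= 1 -> _]mulr_natl.
have hq : C ^- 2 * lfun l t <= lfun l (t / C).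
  have := @ofun_quad_ge _ lfamily (pos l 0) C^-1 t.
  rewrite !lfamilyE lab_pos invr_gt0 Cp invf_le1// C1 => /(_ isT).
  by rewrite exprVn [C^-1 * t]mulrC.
have {hN hq} hl : lfun l t <= 2 * C ^+ 2 * y.
  have h : N%:R * (C ^- 2 * lfun l t) <= 2 * N%:R * y.
    by apply: le_trans yN; apply: le_trans hN; rewrite ler_wpM2l.
  have N0 : 0 < N%:R :> RR by rewrite ltr0n.
  rewrite [2 * _]mulrC -mulrA ler_pM2l// ler_pdivrMl ?exprn_gt0// in h.
  by rewrite (mulrC 2) -mulrA.
have := lfun_ge_kap lk; rewrite -/t => h1.
have := lfun_le_tk l'k; rewrite -/t -yE => h2.
have t2 : 0 < t ^+ 2 by rewrite exprn_gt0.
have C2 : 0 < 2 * C ^+ 2 by rewrite mulr_gt0// exprn_gt0.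
have : kap l * (al RR k / 2) * t ^+ 2 <=
    2 * C ^+ 2 * (2 * al RR k / k.+1%:R + 2) * t ^+ 2.
  apply: le_trans h1 _; apply: le_trans hl _.
  by rewrite -[leRHS]mulrA ler_pM2l// mulrC.
rewrite ler_pM2r// => h3.
have kp : 0 < k.+1%:R :> RR by rewrite ltr0n.
(* This absorbs the additive 2 of [lfun_le_tk]. *)
have ak : 1 <= al RR k / k.+1%:R.
  by rewrite ler_pdivlMr// mul1r ler_nat factS leq_pmulr// fact_gt0.
have a0 : 0 < al RR k by exact: al_gt0.
have {h3} : kap l * (al RR k / 2) <= 2 * C ^+ 2 * (4 * (al RR k / k.+1%:R)).
  apply: le_trans h3 _; rewrite ler_pM2l// -[2 * _ / _]mulrA.
  by move: (al RR k / k.+1%:R) ak => v; lra.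
have -> : 2 * C ^+ 2 * (4 * (al RR k / k.+1%:R)) =
  (16 * C ^+ 2 / k.+1%:R) * (al RR k / 2) by field; rewrite ?gt_eqF.
rewrite ler_pM2r ?divr_gt0// ler_pdivlMr// mulrC -ler_pdivlMr ?kap_gt0//.
by rewrite leNgt qk.
Qed.

Lemma lmodel_le l l' : (l <= l')%O <-> sm_le (lmodel l) (lmodel l').
Proof.
split=> [ll'|]; first by exists (f l').+1%:R => n a; exact: norm_lunit_mono.
by move=> h; apply: contraT => /lmodel_not_dominates.
Qed.

End LatticeSpace.

(** * Spreading models *)

Section Blocks.
Variables (F : orlicz_family RR) (x : nat -> orlicz F).
Hypothesis xnull : forall j (e : RR), 0 < e -> exists n0, forall n, (n0 <= n)%N -> `|x n j| <= e.

Local Notation itv a c := (fun j => (a <= j < c)%N).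

Let head_small a (e : RR) : 0 < e -> exists n0, forall n, (n0 <= n)%N ->
  `|oproj (fun j => (j < a)%N) (x n)| <= e.
Proof.
move=> e0; have e1 : 0 < e / a.+1%:R by rewrite divr_gt0// ltr0n.
have /boolp.choice[N hN] j := xnull j e1.
exists (\max_(j < a) N j) => n hn; rewrite oproj_ltn.
apply: le_trans (ler_norm_sum _ _ _) _.
apply: (@le_trans _ _ (\sum_(j < a) e / a.+1%:R)).
  apply: ler_sum => j _; rewrite normrZ norm_ounit mulr1; apply: hN.
  exact: leq_trans (leq_bigmax j) hn.
rewrite sumr_const card_ord -[X in X <= _]mulr_natr -mulrA ler_piMr ?(ltW e0)//.
by rewrite mulrC ler_pdivrMr ?ltr0n// mul1r ler_nat.
Qed.

(** Gliding hump along the indices satisfying [Q]: skip to a vector whose head is small, then cut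
    its tail. *)
Lemma null_blocks (Q : nat -> Prop) (e : RR) n0 : 0 < e ->
  (forall n, exists2 n', (n <= n')%N & Q n') ->
  exists k c : nat -> nat, [/\ (n0 <= k 0)%N, (forall i, k i < k i.+1)%N,
    (forall i, c i <= c i.+1)%N, (forall i, Q (k i)) &
    forall i, `|x (k i) - oproj (itv (c i) (c i.+1)) (x (k i))| <= e].
Proof.
move=> e0 Qinf; have e2 : 0 < e / 2 by rewrite divr_gt0.
have step (p : nat * nat) : exists q : nat * nat, [/\ (p.1 <= q.1)%N, (p.2 <= q.2)%N,
    Q q.1 & `|x q.1 - oproj (itv p.2 q.2) (x q.1)| <= e].
  case: p => n a; have [n1 h1] := head_small a e2.
  have [n' nn' Qn'] := Qinf (maxn n n1).
  have [a1 ha1] := otail_small (x n') e2.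
  exists (n', maxn a a1) => /=; split=> //.
  - exact: leq_trans (leq_maxl _ _) nn'.
  - exact: leq_maxl.
  have -> : x n' - oproj (itv a (maxn a a1)) (x n') =
      oproj (fun j => (j < a)%N) (x n') + oproj (fun j => (maxn a a1 <= j)%N) (x n').
    apply: orlicz_ext => j; rewrite ovalB ovalD !oprojE.
    case: (ltnP j a) => ja /=.
      by rewrite leqNgt (leq_trans ja (leq_maxl _ _)) subr0 addr0.
    by case: (ltnP j (maxn a a1)) => _; rewrite ?subrr ?subr0 ?addr0 ?add0r.
  apply: le_trans (ler_normD _ _) _.
  have := h1 n' (leq_trans (leq_maxr _ _) nn'); have := ha1 (maxn a a1) (leq_maxr _ _).
  by lra.
have /boolp.choice[g hg] := step.
(* The state holds a lower bound for the next index, with [.+1] forcing strict growth, and the left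
   end of the next interval. *)
pose T := fix T i := if i is i'.+1 then ((g (T i')).1.+1, (g (T i')).2) else (n0, 0%N).
exists (fun i => (g (T i)).1), (fun i => (T i).2); split.
- by have [] := hg (T 0).
- by move=> i; have [] := hg (T i.+1).
- by move=> i; have [] := hg (T i).
- by move=> i; have [] := hg (T i).
by move=> i; have [] := hg (T i).
Qed.

Lemma itv_disjoint (c : nat -> nat) i i' j : (forall i, c i <= c i.+1)%N ->
  (i < i')%N -> ~~ (c i <= j < c i.+1)%N || ~~ (c i' <= j < c i'.+1)%N.
Proof.
move=> cm ii'; have : (c i.+1 <= c i')%N.
  move/subnKC: ii' => <-; elim: (i' - i.+1)%N => [|n IH]; first by rewrite addn0.
  by rewrite addnS; exact: leq_trans IH (cm _).
lia.
Qed.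

End Blocks.

(** * Classification of the spreading models of the space *)

Section SpreadingModels.
Variables (d : Order.disp_t) (L : latticeType d) (f : L -> nat) (b : L).
Hypothesis finj : injective f.
Hypothesis bmin : forall l : L, (b <= l)%O.
Hypothesis Lacc : ~ exists s : nat -> L, forall n, (s n < s n.+1)%O.
Local Notation F := (lfamily f b).
Local Notation X := (orlicz F).
Local Notation lab := (lab f b).
Local Notation lunit := (@lunit _ L f b).
Local Notation lfun := (@lfun _ L f b).
Local Notation lmodel := (@lmodel _ L f b).
Variables (x : nat -> X) (m : seqmodel).
Hypothesis xnorm : normalized x.
Hypothesis xwn : weakly_null x.
Hypothesis xgen : generates_sm x m.

Let xnull j (e : RR) : 0 < e -> exists n0, forall n, (n0 <= n)%N -> `|x n j| <= e.
Proof.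
move=> e0; have /cvg_RRP/(_ e e0)[n0 _ hn] := xwn (coord_dual_elt F j).
by exists n0 => n /hn; rewrite sub0r normrN.
Qed.

(** [eps] decreases to 0, hence is nonnegative and at most [eps 0], which serves as a single
    constant. *)
Let sm_bounds : exists2 E : RR, 0 <= E & forall n (a : nat -> RR) (k : nat -> nat),
  (forall i, (i < n)%N -> `|a i| <= 1) -> (forall i, k i < k i.+1)%N -> (n <= k 0)%N ->
  `|\sum_(i < n) a i *: sm_seq m i| <= (1 + E) * `|\sum_(i < n) a i *: x (k i)| /\
  `|\sum_(i < n) a i *: x (k i)| <= (1 + E) * `|\sum_(i < n) a i *: sm_seq m i|.
Proof.
have [eps [epsd [/cvg_RRP eps0 h]]] := xgen.
have epos n : 0 <= eps n.
  apply/ler_addgt0Pr => e e0; have [n0 _ hn] := eps0 e e0.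
  have := hn (maxn n0 n) (leq_maxl _ _); rewrite sub0r normrN /=.
  have := epsd n (maxn n0 n) (leq_maxr _ _).
  by have := ler_norm (- eps (maxn n0 n)); rewrite normrN; lra.
exists (eps 0) => // n a k a1 km nk.
have kmono i j : (i < j)%N -> (k i < k j)%N.
  by apply: (homo_ltn (r := fun p q => (p < q)%N)) => // ? ? ?; exact: ltn_trans.
have [|||h1 h2] := h n a k.
- by move=> i /a1; rewrite ler_norml.
- by move=> i j ij _; exact: kmono.
- exact: leq_trans nk (leqnSn _).
have e1 : 1 + eps n <= 1 + eps 0 by rewrite lerD2l epsd.
have e0 : 0 < 1 + eps n by rewrite ltr_pwDl.
split.
  move: h1; rewrite ler_pdivrMl// => /le_trans; apply.
  by rewrite ler_wpM2r.
by apply: le_trans h2 _; rewrite ler_wpM2r.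
Qed.

(** By homogeneity, coefficients in [-1, 1] suffice. An arbitrary additive error is allowed, and the
    vectors [x (k i)] may depend on the coefficients. *)
Let dominates_of_lower l (K : RR) : 0 <= K ->
  (forall n (a : nat -> RR) (e : RR), 0 < e -> (forall i, (i < n)%N -> `|a i| <= 1) ->
    exists k : nat -> nat, [/\ (n <= k 0)%N, (forall i, k i < k i.+1)%N &
      `|\sum_(i < n) a i *: lunit l i| <= K * `|\sum_(i < n) a i *: x (k i)| + e]) ->
  dominates m (lmodel l).
Proof.
move=> K0 h; have [E E0 hE] := sm_bounds.
exists (K * (1 + E)) => n a.
pose M := 1 + \sum_(i < n) `|a i|.
have M1 : 1 <= M by rewrite lerDl sumr_ge0.
have M0 : 0 < M by lra.
have a1 i : (i < n)%N -> `|a i / M| <= 1.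
  move=> ni; rewrite normrM normfV (gtr0_norm M0) ler_pdivrMr// mul1r.
  rewrite /M (bigD1 (Ordinal ni))//= addrCA lerDl addr_ge0// sumr_ge0//.
have : `|\sum_(i < n) (a i / M) *: lunit l i| <=
    K * (1 + E) * `|\sum_(i < n) (a i / M) *: sm_seq m i|.
  apply/ler_addgt0Pr => e e0.
  have [k [nk km hk]] := h n (fun i => a i / M) e e0 a1.
  apply: le_trans hk _; rewrite lerD2r -mulrA ler_wpM2l//.
  exact: (hE n (fun i => a i / M) k a1 km nk).2.
have scaleE (V : normedModType RR) (u : nat -> V) :
    `|\sum_(i < n) (a i / M) *: u i| = M^-1 * `|\sum_(i < n) a i *: u i|.
  rewrite -[X in X * _](@gtr0_norm _ M^-1) ?invr_gt0// -normrZ scaler_sumr.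
  by congr `|_|; apply: eq_bigr => i _; rewrite scalerA mulrC.
by rewrite !scaleE mulrCA ler_pM2l ?invr_gt0.
Qed.

Let perturb n (a : nat -> RR) (u v : nat -> X) (e : RR) :
  (forall i, (i < n)%N -> `|a i| <= 1) -> (forall i, `|u i - v i| <= e) ->
  `|\sum_(i < n) a i *: u i| <= `|\sum_(i < n) a i *: v i| + n%:R * e.
Proof.
move=> a1 uv; rewrite -lerBlDl; apply: le_trans (lerB_dist _ _) _.
rewrite -sumrB; apply: le_trans (ler_norm_sum _ _ _) _.
apply: (@le_trans _ _ (\sum_(i < n) e)); last by rewrite sumr_const card_ord mulr_natl.
apply: ler_sum => i _; rewrite -scalerBr normrZ.
apply: le_trans (uv i); rewrite ler_piMl//; exact: a1.
Qed.

Let blk (k c : nat -> nat) i : X := oproj (fun j => (c i <= j < c i.+1)%N) (x (k i)).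

Let big l : Prop := exists2 e : RR, 0 < e &
  forall n, exists2 n', (n <= n')%N & exists2 j, lab j = l & e <= `|x n' j|.

(** Each chosen vector has a large coordinate labelled [l], which must fall into its block; keeping
    only these coordinates does not increase the norm. *)
Lemma dominates_big l : big l -> dominates m (lmodel l).
Proof.
move=> [e0 e0p hl].
apply: (@dominates_of_lower l e0^-1); first by rewrite invr_ge0 ltW.
move=> n a e ep a1.
(* The first bound keeps the large coordinates inside their blocks; the second makes the total error
   at most [e] after division by [e0]. *)
pose dl := Num.min (e0 / 2) (e * e0 / n.+1%:R).
have dp : 0 < dl by rewrite lt_min !divr_gt0 ?mulr_gt0// ltr0n.
have de : dl < e0 by rewrite gt_min; apply/orP; left; lra.
have [k [c [nk km cm hQ hd]]] := null_blocks xnull n dp hl.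
exists k; split=> //.
have /boolp.choice[j hj] i : exists j, lab j = l /\ e0 <= `|x (k i) j|.
  by have [j ? ?] := hQ i; exists j.
have jin i : (c i <= j i < c i.+1)%N.
  apply: contraT => jn; have := oval_le_norm (x (k i) - blk k c i) (j i).
  rewrite ovalB oprojE (negPf jn) subr0 => /le_trans/(_ (hd i)).
  by have [_ h] := hj i; move=> h2; have := lt_le_trans de (le_trans h h2); rewrite ltxx.
have jinj i i' : (i < i' < n)%N -> j i != j i'.
  move=> /andP[ii' _]; apply/eqP => jj.
  by have := itv_disjoint (j i) cm ii'; rewrite jin jj jin.
rewrite -(norm_labelled finj a jinj (l := l)); last by move=> i _; have [] := hj i.
have lower : e0 * `|\sum_(i < n) a i *: ounit F (j i)| <= `|\sum_(i < n) a i *: blk k c i|.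
  rewrite -[X in X * _](gtr0_norm e0p) -normrZ; apply: norm_le_pointwise => q.
  rewrite ovalZ !oval_sum.
  have [[i ni /eqP jq]|hq] := pselect (exists2 i, (i < n)%N & j i == q); last first.
    rewrite [X in `|_ * X| <= _]big1 ?mulr0 ?normr0// => i _.
    rewrite ovalZ ounitE; case: eqP => [/eqP jq|]; rewrite ?mulr0//.
    by case: hq; exists i.
  rewrite [X in `|_ * X| <= _](bigD1 (Ordinal ni))// [X in `|_ * (_ + X)| <= _]big1; last first.
    move=> i' ii'; rewrite ovalZ ounitE -jq.
    case: eqP => [jj|]; rewrite ?mulr0//; move: ii'; rewrite -val_eqE neq_ltn.
    by case/orP => h; [have := jinj i' i|have := jinj i i'];
       rewrite h ?ni ?ltn_ord => /(_ isT)/eqP; rewrite jj.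
  rewrite [X in _ <= `|X|](bigD1 (Ordinal ni))// [X in _ <= `|_ + X|]big1; last first.
    move=> i' ii'; rewrite ovalZ oprojE -jq ifF ?mulr0//.
    move: ii'; rewrite -val_eqE neq_ltn => /orP[] h.
      by have := itv_disjoint (j i) cm h; rewrite jin orbF => /negPf.
    by have := itv_disjoint (j i) cm h; rewrite jin => /negPf.
  rewrite !addr0 !ovalZ ounitE oprojE -jq eqxx mulr1 jin mulrC !normrM.
  by rewrite ler_wpM2l// gtr0_norm//; have [] := hj i.
rewrite -(ler_pM2l e0p).
have pt : `|\sum_(i < n) a i *: blk k c i| <= `|\sum_(i < n) a i *: x (k i)| + n%:R * dl.
  apply: (@perturb n a (blk k c) (fun i => x (k i)) dl a1) => i.
  by rewrite distrC; exact: hd.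
rewrite mulrDr mulrA mulfV ?gt_eqF// mul1r.
apply: le_trans lower _; apply: le_trans pt _; rewrite lerD2l.
apply: (@le_trans _ _ (n.+1%:R * (e * e0 / n.+1%:R))).
  by apply: ler_pM; rewrite ?ler_nat// ?(ltW dp)// ge_min lexx orbT.
by rewrite mulrC divfK ?pnatr_eq0// mulrC.
Qed.

Let blk_disjoint (k c : nat -> nat) i i' j (s s' : RR) : (forall i, c i <= c i.+1)%N ->
  (i < i')%N -> s * blk k c i j = 0 \/ s' * blk k c i' j = 0.
Proof.
move=> cm /(itv_disjoint j cm)/orP[] /negPf h; [left|right];
  by rewrite oprojE h mulr0.
Qed.

Let orho_blk (k c : nat -> nat) n (a : nat -> RR) (r : RR) N :
  (forall i, c i <= c i.+1)%N ->
  orho F (fun j => (\sum_(i < n) a i *: blk k c i) j / r) N =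
  \sum_(i < n) orho F (fun j => a i / r * blk k c i j) N.
Proof.
move=> cm; rewrite -(@orho_sum_disjoint _ F n (fun i j => a i / r * blk k c i j)).
  congr (orho F _ N); apply/funext => j.
  rewrite oval_sum mulr_suml; apply: eq_bigr => i _.
  by rewrite ovalZ mulrAC.
by move=> i i' j /andP[ii' _]; exact: blk_disjoint.
Qed.

Let orho_quad_ge (v : nat -> RR) (r : RR) N : `|r| <= 1 ->
  r ^+ 2 * orho F v N <= orho F (fun j => r * v j) N.
Proof.
move=> r1; have [->|r0] := eqVneq r 0.
  by rewrite expr0n mul0r orho_ge0.
rewrite /orho mulr_sumr; apply: ler_sum => j _.
rewrite -(ofun_norm F j (r * v j)) normrM -(ofun_norm F j (v j)).
rewrite -[r ^+ 2](@real_normK _ r) ?num_real//; apply: ofun_quad_ge.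
by rewrite normr_gt0 r0.
Qed.

(** No scale is active for the minimum, whose unit vectors thus span [l_2]. *)
Let lfun_bot (t : RR) : lfun b t = t ^+ 2.
Proof.
rewrite /lfun /ow hs_eq0 ?mulr0 ?addr0 ?mulr1// => k.
by rewrite /active negbK.
Qed.

(** Disjoint blocks satisfy a lower 2-estimate, since every Orlicz function obeys
    [F (r t) >= r^2 F t] for [|r| <= 1]. *)
Lemma dominates_bot : dominates m (lmodel b).
Proof.
apply: (@dominates_of_lower b 4) => // n a e ep a1.
pose dl := Num.min (1 / 2) (e / 4 / n.+1%:R) : RR.
have dp : 0 < dl by rewrite lt_min !divr_gt0// ltr0n.
have d12 : dl <= 1 / 2 by rewrite ge_min lexx.
have [k [c [nk km cm _ hd]]] :=
  @null_blocks F x xnull (fun=> True) dl n dp (fun n => ex_intro2 _ _ n (leqnn n) I).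
exists k; split=> //.
have u12 i : 1 / 2 <= `|blk k c i|.
  have h2 : `|x (k i) - blk k c i| <= dl := hd i.
  have := ler_normD (x (k i) - blk k c i) (blk k c i).
  rewrite subrK xnorm; move: h2.
  by move: (`|x (k i) - blk k c i|) (`|blk k c i|) => u v; lra.
(* Otherwise [norm_le_orho] would give norm at most 1/2 to [2 *: blk k c i], whose norm is at least
   1. *)
have /boolp.choice[N hN] i : exists N, 4^-1 < orho F (fun j => 2 * blk k c i j) N.
  apply: contrapT => /forallNP h.
  have : `|2 *: blk k c i| <= 1 / 2.
    apply: norm_le_orho; first by lra.
    move=> M; have /negP := h M; rewrite -leNgt => hM.
    have -> : orho F (2 *: blk k c i) M = orho F (fun j => 2 * blk k c i j) M.
      by congr (orho F _ M); apply/funext => j; rewrite ovalZ.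
    by apply: le_trans hM _; rewrite (_ : (1 / 2) ^+ 2 = 4^-1 :> RR)//; field.
  rewrite normrZ ger0_norm//; have := u12 i.
  by move: (`|blk k c i|) => v; lra.
(* One factor 2 of the constant 4 comes from the norm bound 1/2, the other from the modular bound
   1/4. *)
have lower : `|\sum_(i < n) a i *: lunit b i| <= 4 * `|\sum_(i < n) a i *: blk k c i|.
  apply: le_norm_scale => // r r0 /(orlicz_norm_leP _ r0) B.
  have {}B M : \sum_(i < n) orho F (fun j => a i / r * blk k c i j) M <= 1.
    by rewrite -orho_blk.
  have ar i : (i < n)%N -> `|a i / (2 * r)| <= 1.
    move=> ni.
    have : `|(a i / r) *: blk k c i| <= 1.
      apply/orlicz_norm_le1 => M; apply: le_trans (B M).
      rewrite (bigD1 (Ordinal ni))//=.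
      rewrite (_ : orho F _ M = orho F (fun j => a i / r * blk k c i j) M).
        by rewrite lerDl sumr_ge0// => i' _; exact: orho_ge0.
      by congr (orho F _ M); apply/funext => j; rewrite ovalZ.
    rewrite normrZ => h; rewrite invfM mulrCA normrM ger0_norm ?invr_ge0//.
    have := ler_wpM2l (normr_ge0 (a i / r)) (u12 i).
    by move: (`|a i / r|) h => w h; lra.
  apply/(norm_lunit_leP b finj); first by rewrite mulr_gt0.
  pose M := \max_(i < n) N i.
  apply: le_trans (B M); apply: ler_sum => i _; rewrite lfun_bot.
  have -> : (fun j => a i / r * blk k c i j) = (fun j => a i / (2 * r) * (2 * blk k c i j)).
    by apply/funext => j; field; rewrite gt_eqF.
  apply: le_trans (orho_quad_ge _ _ (ar i (ltn_ord i))).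
  have -> : (a i / (4 * r)) ^+ 2 = (a i / (2 * r)) ^+ 2 * 4^-1.
    by field; rewrite gt_eqF.
  rewrite ler_wpM2l ?sqr_ge0//; apply: le_trans (ltW (hN i)) _.
  apply: orho_mono; exact: (leq_bigmax i).
apply: le_trans lower _.
have pt : `|\sum_(i < n) a i *: blk k c i| <= `|\sum_(i < n) a i *: x (k i)| + n%:R * dl.
  apply: (@perturb n a (blk k c) (fun i => x (k i)) dl a1) => i.
  by rewrite distrC; exact: hd.
have : n%:R * dl <= e / 4.
  apply: (@le_trans _ _ (n.+1%:R * (e / 4 / n.+1%:R))).
    by apply: ler_pM; rewrite ?ler_nat// ?(ltW dp)// ge_min lexx orbT.
  by rewrite mulrC divfK// pnatr_eq0.
move=> hnd; apply: le_trans (ler_wpM2l _ pt) _ => //.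
by rewrite mulrDr lerD2l mulrC -ler_pdivlMr.
Qed.

(** * The upper estimate by a label above all big labels *)

Section Upper.
Variable l : L.
Hypothesis lbig : forall l', big l' -> (l' <= l)%O.
(** The 2 comes from [owM2], the other factor from [lfun_mono]. *)
Let K : RR := 2 * (f l).+1%:R.

Let K1 : 1 <= K. Proof. by rewrite mulr_ege1// ler1n. Qed.

Let lfun_sqr_le l' (t : RR) : t ^+ 2 <= lfun l' t.
Proof. by rewrite ler_peMr ?sqr_ge0// (ow_factor_ge1 _ (kap01 f l')). Qed.

(** Labels are addressed by number so that finitely many can be treated at once; injectivity of [f]
    leaves at most one per number. *)
Let flat_index (t : RR) q : t != 0 -> exists n0, forall n, (n0 <= n)%N ->
  forall j, f (lab j) = q -> ~ big (lab j) -> `|x n j| <= `|t|.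
Proof.
move=> t0.
have [[l' [fl nbig]]|h] := pselect (exists l', f l' = q /\ ~ big l'); last first.
  by exists 0%N => n _ j fj nj; case: h; exists (lab j).
have [n0 hn0] : exists n0, forall n, (n0 <= n)%N -> forall j, lab j = l' -> `|x n j| <= `|t|.
  apply: contrapT => /forallNP h; apply: nbig; exists `|t|; first by rewrite normr_gt0.
  move=> n; have /existsNP[n' /not_implyP[nn' /existsNP[j /not_implyP[lj /negP]]]] := h n.
  by rewrite -ltNge => /ltW ?; exists n' => //; exists j.
exists n0 => n hn j fj _; apply: hn0 => //.
by apply: finj; rewrite fj.
Qed.

(** Three cases. A big label is handled by submultiplicativity and [lfun_mono]. A label that is not
    big and has a small number has coordinates eventually below [|t|]; one with a large number has
    tiny [kap]. In both of these [owM2] applies. *)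
Let flat_bound (t : RR) : `|t| <= 1 -> exists n0, forall n, (n0 <= n)%N ->
  forall j, F j (t * x n j) <= K * lfun l t * F j (x n j).
Proof.
move=> t1; have [->|t0] := eqVneq t 0.
  exists 0%N => n _ j; rewrite mul0r ofun0.
  apply: mulr_ge0; last exact: ofun_ge0.
  apply: mulr_ge0; [exact: le_trans ler01 K1|exact: lfun_ge0].
(* From number [Iq] on, [kap] times [hs] at [t] is at most 1. *)
pose Iq := (Num.truncn (hs predT t)).+1.
have /boolp.choice[N hN] q := flat_index q t0.
exists (\max_(q < Iq) N q) => n hn j.
have s1 : `|x n j| <= 1 by rewrite -(xnorm n) oval_le_norm.
have Fs := ofun_ge0 F j (x n j).
have [->|s0] := eqVneq (x n j) 0.
  by rewrite mulr0 ofun0 mulr0.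
have fl0 : 0 <= (f l).+1%:R :> RR by [].
have lt0 : 0 <= lfun l t by exact: lfun_ge0.
have flat : kap f (lab j) * hs (active f b (lab j)) t <=
    1 + kap f (lab j) * hs (active f b (lab j)) (x n j) ->
    F j (t * x n j) <= K * lfun l t * F j (x n j).
  move=> h; apply: le_trans (owM2 (kap01 f (lab j)) t1 s1 t0 s0 h) _.
  apply: ler_wpM2r; first exact: Fs.
  rewrite -[K * _]mulrA; apply: ler_wpM2l => //.
  by apply: le_trans (lfun_sqr_le l t) _; apply: ler_peMl => //; rewrite ler1n.
have [bj|nbj] := pselect (big (lab j)).
  apply: le_trans (owM _ (kap01 f (lab j)) t1 s1) _.
  apply: ler_wpM2r; first exact: Fs.
  apply: le_trans (lfun_mono f b t (lbig bj)) _.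
  by apply: ler_wpM2r => //; apply: ler_peMl => //; rewrite ler1n.
case: (ltnP (f (lab j)) Iq) => fI; apply: flat.
  have xt : `|x n j| <= `|t|.
    apply: (hN (f (lab j)) n _ j) => //.
    exact: leq_trans (leq_bigmax (Ordinal fI)) hn.
  apply: (@le_trans _ _ (kap f (lab j) * hs (active f b (lab j)) (x n j))).
    by apply: ler_wpM2l; [exact: ltW (kap_gt0 f _)|exact: hs_anti].
  by rewrite lerDr ler01.
apply: (@le_trans _ _ 1); last exact: ow_factor_ge1 (kap01 f (lab j)) _.
rewrite /kap ler_pdivrMl ?ltr0n// mulr1.
have h1 : hs (active f b (lab j)) t <= hs predT t by apply: hs_sub.
apply: le_trans h1 _; apply: ltW; apply: lt_le_trans (truncnS_gt _) _.
by rewrite ler_nat (leq_trans fI).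
Qed.

(** Late vectors satisfy [flat_bound] for all the finitely many coefficients at once, so the
    modulars of the scaled blocks add up to give norm at most [K]; the block approximation costs at
    most 1 more. *)
Lemma dominated_by : dominates (lmodel l) m.
Proof.
have [E E0 hE] := sm_bounds.
have E1 : 0 <= 1 + E by rewrite addr_ge0.
exists ((1 + E) * (K + 1)) => n a.
apply: le_norm_scale; first by rewrite mulr_ge0// addr_ge0// (le_trans ler01).
move=> r r0 /(norm_lunit_leP b finj _ _ _ r0) h.
pose t i := a i / r.
have t1 i : (i < n)%N -> `|t i| <= 1.
  move=> ni; apply: (@ofun_le1 _ F (pos f l 0)); rewrite lfamilyE lab_pos//.
  apply: le_trans h; rewrite (bigD1 (Ordinal ni))//= lerDl.
  by apply: sumr_ge0 => i' _; exact: lfun_ge0.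
have /boolp.choice[N hN] i : exists n0, (i < n)%N -> forall n', (n0 <= n')%N ->
    forall j, F j (t i * x n' j) <= K * lfun l (t i) * F j (x n' j).
  case: (ltnP i n) => [/t1/flat_bound[n0 hn0]|_]; last by exists 0%N.
  by exists n0.
pose Q n' := forall i, (i < n)%N ->
  forall j, F j (t i * x n' j) <= K * lfun l (t i) * F j (x n' j).
have Qinf n1 : exists2 n', (n1 <= n')%N & Q n'.
  exists (maxn n1 (\max_(i < n) N i)); first exact: leq_maxl.
  move=> i ni; apply: hN => //.
  exact: leq_trans (leq_bigmax (Ordinal ni)) (leq_maxr _ _).
have dp : 0 < n.+1%:R^-1 :> RR by rewrite invr_gt0 ltr0n.
have [k [c [nk km cm hQ hd]]] := null_blocks xnull n dp Qinf.
have K0 : 0 < K by exact: lt_le_trans K1.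
have ub : `|\sum_(i < n) t i *: blk k c i| <= K.
  apply/orlicz_norm_leP => // M; rewrite orho_blk//.
  apply: (@le_trans _ _ (\sum_(i < n) lfun l (t i))); last exact: h.
  apply: ler_sum => i _.
  apply: (@le_trans _ _ (K^-1 * orho F (fun j => t i * blk k c i j) M)).
    rewrite /orho mulr_sumr; apply: ler_sum => j _.
    rewrite (_ : t i / K * _ = K^-1 * (t i * blk k c i j)); last by rewrite mulrA [K^-1 * _]mulrC.
    by apply: ofun_scale; rewrite invr_ge0 (ltW K0)/= invf_le1.
  rewrite ler_pdivrMl//.
  apply: (@le_trans _ _ (K * lfun l (t i) * orho F (x (k i)) M)).
    rewrite /orho mulr_sumr; apply: ler_sum => j _; rewrite oprojE.
    case: ifP => _; first exact: hQ.
    rewrite mulr0 ofun0; apply: mulr_ge0; last exact: ofun_ge0.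
    by apply: mulr_ge0; [exact: ltW|exact: lfun_ge0].
  apply: ler_piMr; first by apply: mulr_ge0; [exact: ltW|exact: lfun_ge0].
  have /orlicz_norm_le1 Bx : `|x (k i)| <= 1 by rewrite xnorm.
  exact: Bx.
have pt := @perturb n t (fun i => x (k i)) (blk k c) _ t1 hd.
have n1 : n%:R * n.+1%:R^-1 <= 1 :> RR by rewrite ler_pdivrMr ?ltr0n// mul1r ler_nat.
have := (hE n t k t1 km nk).1.
have -> : `|\sum_(i < n) t i *: sm_seq m i| = r^-1 * `|\sum_(i < n) a i *: sm_seq m i|.
  rewrite -[X in X * _](@gtr0_norm _ r^-1) ?invr_gt0// -normrZ scaler_sumr.
  by congr `|_|; apply: eq_bigr => i _; rewrite scalerA mulrC.
rewrite ler_pdivrMl// => /le_trans; apply.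
rewrite mulrC ler_pM2r// ler_wpM2l//.
by apply: le_trans pt _; apply: lerD.
Qed.

End Upper.

(** The labels dominated by [m] include the minimum and all big labels, and are closed under joins.
    If none were above all big labels, joining with a missed one could be repeated forever, against
    the chain condition. *)
Lemma spreading_model_classified : exists l, sm_equiv m (lmodel l).
Proof.
have joinD l1 l2 : dominates m (lmodel l1) -> dominates m (lmodel l2) ->
    dominates m (lmodel (l1 `|` l2)%O).
  move=> [C1 h1] [C2 h2].
  exists (2 * ((f l1).+1 + (f l2).+1)%:R * (C1 + C2)) => n a.
  apply: le_trans (norm_lunit_join b finj l1 l2 n a) _.
  rewrite -[leRHS]mulrA; apply: ler_wpM2l; first by rewrite mulr_ge0.
  by rewrite mulrDl; exact: lerD (h1 n a) (h2 n a).
suff [l [dl hl]] : exists l, dominates m (lmodel l) /\ forall l', big l' -> (l' <= l)%O.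
  by exists l; split => //; exact: dominated_by.
apply: contrapT => /forallNP h.
(* The domination travels with the label, so that the step can be iterated. *)
have step (p : {l | dominates m (lmodel l)}) :
    exists q : {l | dominates m (lmodel l)}, (projT1 p < projT1 q)%O.
  case: p => l dl /=; have /not_andP[//|/existsNP[l' /not_implyP[bl' /negP ll']]] := h l.
  have dl' := joinD l l' dl (dominates_big bl').
  exists (exist _ (l `|` l')%O dl') => /=.
  rewrite lt_neqAle leUl andbT; apply: contra ll' => /eqP ->.
  exact: leUr.
have /boolp.choice[g hg] := step.
apply: Lacc; exists (fun n => projT1 (iter n g (exist _ b dominates_bot))) => n.
exact: hg.
Qed.

End SpreadingModels.

(* (SP_w(X), <=) order-isomorphic to L: a map phi from L into representatives
   of SP_w(X), hitting every equivalence class, with l <= l' <-> [phi l] <= [phi l']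
   (injectivity on classes follows from antisymmetry in L). *)
Theorem theorem3p1 (d : Order.disp_t) (L : latticeType d)
  (Lcount : exists f : L -> nat, injective f)
  (Lmin : exists b : L, forall x : L, (b <= x)%O)
  (Lacc : ~ exists s : nat -> L, forall n : nat, (s n < s n.+1)%O) :
  exists X : completeNormedModType RR,
    reflexive_space X /\
    exists phi : L -> seqmodel,
      (forall l : L, in_SPw X (phi l)) /\
      (forall m : seqmodel, in_SPw X m -> exists l : L, sm_equiv m (phi l)) /\
      (forall l l' : L, (l <= l')%O <-> sm_le (phi l) (phi l')).
Proof.
case: Lcount Lmin => f finj [b bmin].
exists (lspace f b); split; first exact: orlicz_reflexive.
exists (lmodel f b); split; first exact: lmodel_in_SPw.
split; last exact: lmodel_le.
move=> m [x [xnorm [xwn [_ xgen]]]].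
exact: (@spreading_model_classified _ _ _ _ finj bmin Lacc x).
Qed.
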